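(* If $\Lambda$ is cyclic (and nontrivial), then the group $\mathbf F(r,\Lambda,A)$ interprets the Arithmetic $(\mathbb N,+,\times)$ without parameters.
   Context: Maps act on the right: $(\alpha)x$ is the image of $\alpha$ under $x$, and $xy$ means ''first $x$, then $y$''. Fix a real $r>0$, a subgroup $\Lambda\neq\{1\}$ of the multiplicative group $\mathbb R^*_+$, and an additive subgroup $A\subseteq\mathbb R$ with $r\in A$ and $\lambda A\subseteq A$ for all $\lambda\in\Lambda$. $\mathbf V(r,\Lambda,A)$ is the group of all bijections $x\colon[0,r)\to[0,r)$ such that: $x$ is piecewise affine with finitely many breakpoints and discontinuity points; $x$ is right-continuous everywhere; every slope lies in $\Lambda$; all breakpoints and discontinuity points of $x$, and their images, lie in $A$. $\mathbf F(r,\Lambda,A)$ is the subgroup of elements continuous for the usual topology of $[0,r)$. Groups are first-order structures in the language with one binary function symbol. An interpretation without parameters of $M$ in $N$ is a pair $(n,f)$, $n\in\mathbb N$, $f$ a surjection from a subset of $N^n$ onto $M$ such that for every $X\subseteq M^k$ definable in $M$ without parameters, the preimage of $X$ under the coordinatewise map $f^{\underline k}$ is definable in $N$ without parameters (equivalently: domain of $f$, kernel of $f$, and preimages of graphs of the basic operations/relations of $M$ are definable without parameters). *)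

(* Defs.v *)
From Stdlib Require Import Reals ZArith Arith.
Open Scope R_scope.

Inductive term (S : Type) : Type :=
| Var : nat -> term S
| App : S -> term S -> term S -> term S.
Arguments Var {S} _.
Arguments App {S} _ _ _.

Inductive formula (S : Type) : Type :=
| FEq  : term S -> term S -> formula S
| FNeg : formula S -> formula S
| FAnd : formula S -> formula S -> formula S
| FEx  : nat -> formula S -> formula S.
Arguments FEq {S} _ _.
Arguments FNeg {S} _.
Arguments FAnd {S} _ _.
Arguments FEx {S} _ _.

Definition upd {M : Type} (e : nat -> M) (v : nat) (a : M) : nat -> M :=
  fun i => if Nat.eqb i v then a else e i.

(* A structure is given by a carrier type M, a universe D ⊆ M and interpretations
   op s of the binary function symbols. *)
Fixpoint eval {S M : Type} (op : S -> M -> M -> M) (e : nat -> M) (t : term S) : M :=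
  match t with
  | Var i => e i
  | App s t1 t2 => op s (eval op e t1) (eval op e t2)
  end.

Fixpoint sat {S M : Type} (D : M -> Prop) (op : S -> M -> M -> M)
  (e : nat -> M) (phi : formula S) : Prop :=
  match phi with
  | FEq t1 t2 => eval op e t1 = eval op e t2
  | FNeg psi => ~ sat D op e psi
  | FAnd p q => sat D op e p /\ sat D op e q
  | FEx v psi => exists a, D a /\ sat D op (upd e v a) psi
  end.

(* X (a predicate on assignments, meant to depend only on finitely many coordinates)
   is definable without parameters: some formula agrees with X on every assignment
   with values in the universe. *)
Definition definable {S M : Type} (D : M -> Prop) (op : S -> M -> M -> M)
  (X : (nat -> M) -> Prop) : Prop :=
  exists phi : formula S, forall e : nat -> M, (forall i, D (e i)) ->
    (X e <-> sat D op e phi).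

Definition arith_op (b : bool) : nat -> nat -> nat :=
  if b then Nat.add else Nat.mul.
Definition arith_univ (_ : nat) : Prop := True.

Definition block {M : Type} (n : nat) (y : nat -> M) (j : nat) : nat -> M :=
  fun i => y (j * n + i)%nat.

(* Interpretation without parameters of (N,+,x) in the structure (D, op):
   an n and a surjection f from dom ⊆ D^n onto N such that the preimage under f^k
   of every parameter-free definable X ⊆ N^k is parameter-free definable.
   Every definable X ⊆ N^k is {u | forall e extending u, e |= psi} for some psi. *)
Definition interprets_arith {S M : Type} (D : M -> Prop) (op : S -> M -> M -> M) : Prop :=
  exists (n : nat) (dom : (nat -> M) -> Prop) (f : (nat -> M) -> nat),
    (forall y y', (forall i, (i < n)%nat -> y i = y' i) -> (dom y <-> dom y') /\ f y = f y') /\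
    (forall y, dom y -> forall i, (i < n)%nat -> D (y i)) /\
    (forall m : nat, exists y, dom y /\ f y = m) /\
    (forall (k : nat) (psi : formula bool),
       definable D op (fun y =>
         (forall j, (j < k)%nat -> dom (block n y j)) /\
         (forall e : nat -> nat, (forall j, (j < k)%nat -> e j = f (block n y j)) ->
            sat arith_univ arith_op e psi))).

(* Elements are represented as maps R -> R equal to the identity outside [0,r). *)
Definition inF (r : R) (Lam A : R -> Prop) (x : R -> R) : Prop :=
  (forall t, ~ (0 <= t < r) -> x t = t) /\
  (forall t, 0 <= t < r -> 0 <= x t < r) /\
  (forall s, 0 <= s < r -> exists t, 0 <= t < r /\ x t = s) /\
  (forall t t', 0 <= t < r -> 0 <= t' < r -> x t = x t' -> t = t') /\
  (exists (n : nat) (a lam b : nat -> R),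
     a 0%nat = 0 /\ a n = r /\
     forall i, (i < n)%nat ->
       a i < a (S i) /\ A (a i) /\ A (x (a i)) /\ Lam (lam i) /\
       forall t, a i <= t < a (S i) -> x t = lam i * t + b i) /\
  (forall t, 0 <= t < r -> limit1_in x (fun y => 0 <= y < r) (x t) t).

(* maps act on the right: x y = first x, then y *)
Definition Fop (_ : unit) (x y : R -> R) : R -> R := fun t => y (x t).

(* Main.v *)
Require Import Defs.
From Stdlib Require Import Reals ZArith Arith Lia Lra Classical ClassicalEpsilon
  FunctionalExtensionality PropExtensionality.

(* Let v_0(x) and v_r(x) be the logarithms, to the base of a generator of Lambda, of the
   slopes of x at the two ends of [0, r).  A natural number n is coded by any x with value
   n at one end, and the end is coded by an element that is trivial near that end but not
   near the other.  First-order definability rests on three facts.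
   - x is trivial near some end iff for every u the centralizers of x and of its conjugate
     by u have a common nontrivial element.  From this both kernels of v_0 and v_r are
     definable once one end has been named.
   - The sign of the slope at an end is detected by the action of x by conjugation on the
     elements supported near that end.
   - If the centralizer of x contains no nontrivial element that is trivial near an end,
     as when x has no fixed point in (0, r), then the pairs (v_0(y), v_r(y)) for y commuting
     with x are proportional.  With x of values (n, -1), the y of values (z, -q) commuting
     with x are those with z = n q, which defines the multiplication. *)

(** The flip t -> r - t conjugates the group onto itself and exchanges the two ends, so no formula
    without parameters can single out one of them. This is why each code carries its own marker, and
    why codes placed at different ends have to be compared. Cyclicity of Lambda makes the values
    integers. The generator is taken below 1, so that a positive value means that the end attracts.
    An element that moves every interior point to the left attracts at 0 and repels at r, whence the
    opposite signs in the values (n, -1). The dynamical facts all come from one principle: if h and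
    k commute and h has no fixed point between two consecutive fixed points, then a fixed point of k
    in that gap makes k trivial on the whole gap. *)

Lemma upd_same {M : Type} (e : nat -> M) m a : upd e m a m = a.
Proof. unfold upd. now rewrite Nat.eqb_refl. Qed.

Lemma upd_other {M : Type} (e : nat -> M) m a i : i <> m -> upd e m a i = e i.
Proof. intros H. unfold upd. now rewrite (proj2 (Nat.eqb_neq i m) H). Qed.

(** * Definable relations *)

Section Definability.
Local Open Scope nat_scope.
Context {S M : Type} (D : M -> Prop) (op : S -> M -> M -> M).
Implicit Types X Y : (nat -> M) -> Prop.
Notation def := (definable D op).

Lemma definable_iff X Y :
  (forall e, (forall i, D (e i)) -> (X e <-> Y e)) -> def X -> def Y.
Proof.
  intros H [phi Hphi]. exists phi. intros e He. rewrite <- (H e He). auto.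
Qed.

Lemma definable_eval t1 t2 : def (fun e => eval op e t1 = eval op e t2).
Proof. exists (FEq t1 t2). intros e _. reflexivity. Qed.

Lemma definable_not X : def X -> def (fun e => ~ X e).
Proof. intros [phi H]. exists (FNeg phi). intros e He. simpl. rewrite <- (H e He). tauto. Qed.

Lemma definable_and X Y : def X -> def Y -> def (fun e => X e /\ Y e).
Proof.
  intros [phi H] [psi H']. exists (FAnd phi psi). intros e He. simpl.
  rewrite <- (H e He), <- (H' e He). tauto.
Qed.

Lemma definable_or X Y : def X -> def Y -> def (fun e => X e \/ Y e).
Proof.
  intros HX HY. apply definable_iff with (fun e => ~ (~ X e /\ ~ Y e)).
  - intros e _. destruct (classic (X e)), (classic (Y e)); tauto.
  - auto using definable_not, definable_and.
Qed.

Lemma definable_imp X Y : def X -> def Y -> def (fun e => X e -> Y e).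
Proof.
  intros HX HY. apply definable_iff with (fun e => ~ (X e /\ ~ Y e)).
  - intros e _. destruct (classic (X e)), (classic (Y e)); tauto.
  - auto using definable_not, definable_and.
Qed.

Lemma definable_upd_ex X v : def X -> def (fun e => exists a, D a /\ X (upd e v a)).
Proof.
  intros [phi H]. exists (FEx v phi). intros e He. simpl.
  assert (Hu : forall a, D a -> (X (upd e v a) <-> sat D op (upd e v a) phi)).
  { intros a Ha. apply H. intros i. unfold upd. destruct (Nat.eqb i v); auto. }
  split; intros (a & Ha & Hx); exists a; split; auto; apply (Hu a Ha); auto.
Qed.

(** The body is a predicate in the quantified element itself, so that relations can be written
    without variable indices. The index [m] is left arbitrary above [N]: it enters the context as a
    variable, and the bound for a nested quantifier takes it into account. *)
Lemma definable_ex N (F : (nat -> M) -> M -> Prop) :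
  (forall m, N <= m ->
     def (fun e => F e (e m)) /\ forall e a b, F (upd e m a) b <-> F e b) ->
  def (fun e => exists a, D a /\ F e a).
Proof.
  intros H. destruct (H N (le_n N)) as [HF Hu].
  refine (definable_iff _ _ _ (definable_upd_ex _ N HF)).
  intros e _. split; intros (a & Ha & Hx); exists a; split; auto.
  - rewrite upd_same in Hx. now apply Hu in Hx.
  - rewrite upd_same. now apply Hu.
Qed.

Lemma definable_all N (F : (nat -> M) -> M -> Prop) :
  (forall m, N <= m ->
     def (fun e => F e (e m)) /\ forall e a b, F (upd e m a) b <-> F e b) ->
  def (fun e => forall a, D a -> F e a).
Proof.
  intros H. apply definable_iff with (fun e => ~ exists a, D a /\ ~ F e a).
  - intros e _. split.
    + intros Hn a Ha. apply NNPP. intros Hf. apply Hn. eauto.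
    + intros Hall (a & Ha & Hf). auto.
  - apply definable_not, definable_ex with N. intros m Hm.
    destruct (H m Hm) as [HF Hu]. split.
    + now apply definable_not.
    + intros e a b. specialize (Hu e a b). tauto.
Qed.

End Definability.

Create HintDb definable.

(** The result exceeds every natural number in the context, so every index from it on is distinct
    from those already in use. *)
Ltac nat_bound acc :=
  match goal with
  | n : nat |- _ =>
      match acc with
      | context [n] => fail 1
      | _ => nat_bound (S (n + acc)%nat)
      end
  | _ => acc
  end.

Ltac fresh_variable :=
  intros ? ?; split; [ | intros; cbv beta; rewrite ?upd_other by lia; reflexivity ].

Ltac definability :=
  intros; cbv beta;
  repeat first
    [ solve [eauto 2 with definable]
    | apply definable_not
    | apply definable_and
    | apply definable_or
    | (let N := nat_bound 0%nat in apply (definable_ex _ _ N)); fresh_variable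
    | (let N := nat_bound 0%nat in apply (definable_all _ _ N)); fresh_variable
    | apply definable_imp ].

(** * Groups with two valued ends *)

Section TwoEnded.
Local Open Scope Z_scope.
Context {M : Type} (D : M -> Prop) (op : unit -> M -> M -> M) (one : M) (v : bool -> M -> Z).
Notation mul := (op tt).
Notation def := (definable D op).

Definition commute x y := mul x y = mul y x.
Definition thin x := v true x = 0 \/ v false x = 0.
Definition rigid x := forall y, D y -> commute x y -> thin y -> y = one.

(** The interface between logic and dynamics. The equation [mul u h' = mul h u] expresses that h' is
    the conjugate of h by u without a symbol for inverses. The right-hand sides of [thin_iff] and
    [nonneg_iff] are the future defining formulas; in the second, the conditions on values being 0
    become definable once an end is marked. *)
Record two_ended : Prop := {
  one_mem : D one;
  mul_mem x y : D x -> D y -> D (mul x y);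
  inv_mem x : D x -> exists y, D y /\ mul x y = one /\ mul y x = one;
  mulA x y z : mul x (mul y z) = mul (mul x y) z;
  mul1l x : mul one x = x;
  mul1r x : mul x one = x;
  val_mul e x y : D x -> D y -> v e (mul x y) = v e x + v e y;
  thin_iff h : D h ->
    (thin h <-> forall u, D u -> exists k, D k /\ k <> one /\ commute h k /\
       exists h', D h' /\ mul u h' = mul h u /\ commute h' k);
  nonneg_iff e x : D x ->
    (0 <= v e x <->
     forall k1, D k1 -> v e k1 = 0 -> k1 <> one ->
     exists k, D k /\ v e k = 0 /\ k <> one /\
       forall h, D h -> v (negb e) h = 0 -> commute h k ->
         commute h k1 /\ exists h', D h' /\ mul x h' = mul h x /\ commute h' k);
  rigid_ex e m : 0 < m -> exists x, D x /\ rigid x /\ v e x = m /\ v (negb e) x = -1;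
  one_sided_ex e : exists p, D p /\ v e p = 0 /\ v (negb e) p <> 0
}.

Hypothesis G : two_ended.

Let one_mem := one_mem G.
Let mul_mem := mul_mem G.
Let mulA := mulA G.
Let mul1l := mul1l G.
Let mul1r := mul1r G.
Let val_mul := val_mul G.
Local Hint Resolve one_mem mul_mem : core.

(** * Group laws, values and powers *)

Lemma val_one e : v e one = 0.
Proof. pose proof (val_mul e one one one_mem one_mem) as H. rewrite mul1l in H. lia. Qed.

Lemma val_inv e x y : D x -> D y -> mul x y = one -> v e y = - v e x.
Proof. intros Hx Hy H. pose proof (val_mul e x y Hx Hy). rewrite H, val_one in *. lia. Qed.

Lemma left_quotient x z : D x -> D z -> exists q, D q /\ mul x q = z.
Proof.
  intros Hx Hz. destruct (inv_mem G x Hx) as (y & Hy & H1 & H2).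
  exists (mul y z). split; auto. rewrite mulA, H1. auto.
Qed.

Lemma right_quotient x z : D x -> D z -> exists q, D q /\ mul q x = z.
Proof.
  intros Hx Hz. destruct (inv_mem G x Hx) as (y & Hy & H1 & H2).
  exists (mul z y). split; auto. rewrite <- mulA, H2. auto.
Qed.

Lemma square_one x : D x -> mul x x = x -> x = one.
Proof.
  intros Hx H. destruct (inv_mem G x Hx) as (y & Hy & H1 & H2).
  rewrite <- (mul1l x), <- H2, <- mulA, H. reflexivity.
Qed.

Lemma commute_mul x y k : commute x k -> commute y k -> commute (mul x y) k.
Proof.
  unfold commute. intros H1 H2. now rewrite <- mulA, H2, mulA, H1, mulA.
Qed.

Lemma commute_inv x y k : mul x y = one -> mul y x = one -> commute x k -> commute y k.
Proof.
  unfold commute. intros H1 H2 H.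
  rewrite <- (mul1r (mul y k)), <- H1, mulA, <- (mulA y k x), <- H, (mulA y x k), H2, mul1l.
  reflexivity.
Qed.

(** Later arguments use a power only through its values and through the elements that it commutes
    with, so nothing else is recorded. *)
Lemma power_ex x z : D x ->
  exists y, D y /\ (forall e, v e y = z * v e x) /\ forall k, commute x k -> commute y k.
Proof.
  intros Hx.
  assert (Hn : forall n : nat, exists y, D y /\ (forall e, v e y = Z.of_nat n * v e x) /\
                forall k, commute x k -> commute y k).
  { induction n as [|n (y & Hy & Hv & Hc)].
    - exists one. split; [auto|split].
      + intros e. rewrite val_one. lia.
      + intros k _. unfold commute. now rewrite mul1l, mul1r.
    - exists (mul x y). split; [auto|split].
      + intros e. rewrite val_mul, Hv by auto. lia.
      + intros k Hk. apply commute_mul; auto. }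
  destruct (Hn (Z.abs_nat z)) as (y & Hy & Hv & Hc).
  destruct (Z.le_ge_cases 0 z) as [Hz|Hz].
  - exists y. split; [auto|split; auto]. intros e. rewrite Hv. f_equal. lia.
  - destruct (inv_mem G y Hy) as (y' & Hy' & H1 & H2).
    exists y'. split; [auto|split].
    + intros e. rewrite (val_inv e y y'), Hv by auto.
      replace (Z.of_nat (Z.abs_nat z)) with (- z) by lia. lia.
    + intros k Hk. apply (commute_inv y); auto.
Qed.

Lemma commute_sym x y : commute x y -> commute y x.
Proof. unfold commute. auto. Qed.

(* The image of the centralizer of a rigid element under both valuations meets
   the axes trivially, so it has rank one. *)
Lemma rigid_proportional e x y : D x -> D y -> rigid x -> commute x y ->
  v e x * v (negb e) y = v e y * v (negb e) x.
Proof.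
  intros Hx Hy Hr Hc.
  destruct (power_ex x (v true y) Hx) as (x1 & Hx1 & Vx1 & Cx1).
  destruct (power_ex y (v true x) Hy) as (y1 & Hy1 & Vy1 & Cy1).
  (* [q] is x^(-v(y)) y^(v(x)), the exponents being the values at the end [true]. Its value there is
     0, so it is thin and rigidity makes it the identity; that its value at the other end is 0 as
     well is the claim. *)
  destruct (left_quotient x1 y1 Hx1 Hy1) as (q & Hq & Eq).
  destruct (inv_mem G x1 Hx1) as (x2 & Hx2 & I1 & I2).
  assert (Eq2 : q = mul x2 y1) by (rewrite <- Eq, mulA, I2; auto).
  assert (Vq : forall e, v e q = v true x * v e y - v true y * v e x).
  { intros e'. pose proof (val_mul e' x1 q Hx1 Hq) as H. rewrite Eq, Vx1, Vy1 in H. lia. }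
  assert (q = one).
  { apply Hr; auto.
    - apply commute_sym. rewrite Eq2. apply commute_mul.
      + apply (commute_inv x1); auto. apply Cx1. reflexivity.
      + apply Cy1. now apply commute_sym.
    - left. rewrite Vq. lia. }
  pose proof (Vq false) as H1. rewrite H, val_one in H1.
  destruct e; simpl; lia.
Qed.

Lemma val_ex e n : exists x, D x /\ v e x = n.
Proof.
  destruct (rigid_ex G e 1) as (x & Hx & _ & Vx & _); [lia|].
  destruct (power_ex x n Hx) as (y & Hy & Vy & _).
  exists y. split; auto. rewrite Vy, Vx. lia.
Qed.

(* An element that is trivial at exactly one end distinguishes that end. *)
Definition marks p := xorb (v true p =? 0) (v false p =? 0).
Definition marked p : bool := v true p =? 0.

Lemma marks_val p : marks p = true -> v (marked p) p = 0 /\ v (negb (marked p)) p <> 0.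
Proof.
  unfold marks, marked. intros H.
  destruct (Z.eqb_spec (v true p) 0), (Z.eqb_spec (v false p) 0); simpl in *; auto; discriminate.
Qed.

Lemma marks_intro e p : v e p = 0 -> v (negb e) p <> 0 -> marks p = true /\ marked p = e.
Proof.
  unfold marks, marked. intros H1 H2.
  destruct e; simpl in *; rewrite (proj2 (Z.eqb_eq _ _) H1), (proj2 (Z.eqb_neq _ _) H2); auto.
Qed.

Lemma marks_iff p : marks p = true <-> thin p /\ ~ (v true p = 0 /\ v false p = 0).
Proof.
  unfold marks, thin.
  destruct (Z.eqb_spec (v true p) 0), (Z.eqb_spec (v false p) 0); simpl; split; try tauto; discriminate.
Qed.

(** * Definability of the ends and of the values *)

Lemma definable_mul i j k l : def (fun e => mul (e i) (e j) = mul (e k) (e l)).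
Proof. exact (definable_eval D op (App tt (Var i) (Var j)) (App tt (Var k) (Var l))). Qed.

Lemma definable_mul1 i j k : def (fun e => mul (e i) (e j) = e k).
Proof. exact (definable_eval D op (App tt (Var i) (Var j)) (Var k)). Qed.

Lemma definable_is_one i : def (fun e => e i = one).
Proof.
  apply definable_iff with (fun e => mul (e i) (e i) = e i).
  - intros e He. split; [now apply square_one|]. intros ->. auto.
  - apply definable_mul1.
Qed.

Lemma definable_commute i j : def (fun e => commute (e i) (e j)).
Proof. apply definable_mul. Qed.

Local Hint Resolve definable_mul definable_mul1 definable_is_one definable_commute : definable.

Lemma definable_thin i : def (fun e => thin (e i)).
Proof.
  eapply definable_iff; [intros e He; symmetry; exact (thin_iff G (e i) (He i))|].
  definability.
Qed.
Local Hint Resolve definable_thin : definable.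

Lemma definable_rigid i : def (fun e => rigid (e i)).
Proof. unfold rigid. definability. Qed.
Local Hint Resolve definable_rigid : definable.

(** Taking q = [one] shows that h is thin. If h is nontrivial at exactly one end, a q that is
    nontrivial at exactly the other end makes h q nontrivial at both. The product gets the name [s]
    because definability of [thin] is stated for variables, not for terms. *)
Lemma trivial_iff h : D h ->
  (v true h = 0 /\ v false h = 0 <-> forall q, D q -> thin q -> exists s, D s /\ mul h q = s /\ thin s).
Proof.
  intros Hh. split.
  - intros [H1 H2] q Hq Tq. exists (mul h q). split; [auto|split; auto].
    unfold thin in *. rewrite !val_mul by auto. lia.
  - intros H.
    destruct (one_sided_ex G true) as (p & Hp & P1 & P2).
    destruct (one_sided_ex G false) as (q & Hq & Q1 & Q2).
    destruct (H p Hp (or_introl P1)) as (s & _ & <- & Ts).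
    destruct (H q Hq (or_intror Q1)) as (s & _ & <- & Ts').
    destruct (H one one_mem (or_introl (val_one true))) as (s & _ & <- & Ts'').
    unfold thin in *. rewrite !val_mul, ?val_one in * by auto. simpl in *. lia.
Qed.

Lemma definable_marks i : def (fun e => marks (e i) = true).
Proof.
  eapply definable_iff; [intros e He; symmetry; apply marks_iff|].
  apply definable_and; [definability|]. apply definable_not.
  eapply definable_iff; [intros e He; symmetry; apply (trivial_iff (e i) (He i))|].
  definability.
Qed.
Local Hint Resolve definable_marks : definable.

Definition near p h := marks p = true /\ v (marked p) h = 0.

(** If h is thin but nontrivial at the end marked by p, then h p is nontrivial at both ends, because
    p is nontrivial at the other one. *)
Lemma near_iff p h : D p -> D h ->
  (near p h <-> marks p = true /\ thin h /\ exists s, D s /\ mul h p = s /\ thin s).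
Proof.
  intros Hp Hh. unfold near. split.
  - intros [Mp Vh]. destruct (marks_val p Mp) as [P1 P2]. split; [auto|].
    assert (T : forall x, v (marked p) x = 0 -> thin x).
    { unfold thin. intros x Hx. destruct (marked p); auto. }
    split; [auto|]. exists (mul h p). split; [auto|split; auto].
    apply T. rewrite val_mul by auto. lia.
  - intros (Mp & Th & s & _ & <- & Ts). split; [auto|].
    destruct (marks_val p Mp) as [P1 P2]. unfold thin in *. rewrite !val_mul in Ts by auto.
    destruct (marked p); simpl in *; lia.
Qed.

Lemma definable_near i j : def (fun e => near (e i) (e j)).
Proof.
  eapply definable_iff; [intros e He; symmetry; apply (near_iff (e i) (e j) (He i) (He j))|].
  definability.
Qed.
Local Hint Resolve definable_near : definable.

Definition opposite p q := marks p = true /\ marks q = true /\ ~ near p q.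

Lemma opposite_marked p q : opposite p q -> marked q = negb (marked p).
Proof.
  intros (Hp & Hq & Hn). destruct (marks_val q Hq) as [Q1 Q2]. unfold near in Hn.
  destruct (marked q), (marked p); simpl in *; auto; tauto.
Qed.

Lemma near_marked p q : marks p = true -> marks q = true -> (near p q <-> marked q = marked p).
Proof.
  intros Hp Hq. destruct (marks_val q Hq) as [Q1 Q2]. unfold near.
  destruct (marked q), (marked p); simpl in *; intuition congruence.
Qed.

Lemma marks_ex e : exists p, D p /\ marks p = true /\ marked p = e.
Proof.
  destruct (one_sided_ex G e) as (p & Hp & P1 & P2). exists p. split; auto.
  now apply marks_intro.
Qed.

Lemma opposite_ex p : marks p = true -> exists q, D q /\ opposite p q.
Proof.
  intros Hp. destruct (marks_ex (negb (marked p))) as (q & Hq & Mq & Eq).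
  exists q. split; [auto|]. split; [auto|split; auto].
  rewrite near_marked, Eq by auto. destruct (marked p); discriminate.
Qed.

Lemma definable_opposite i j : def (fun e => opposite (e i) (e j)).
Proof. unfold opposite. definability. Qed.
Local Hint Resolve definable_opposite : definable.

Definition far p h := marks p = true /\ v (negb (marked p)) h = 0.

Lemma far_iff p h : marks p = true ->
  (far p h <-> exists q, D q /\ opposite p q /\ near q h).
Proof.
  intros Mp. unfold far. split.
  - intros [_ Vh]. destruct (opposite_ex p Mp) as (q & Hq & Oq). exists q.
    split; [auto|split; auto]. split; [apply Oq|]. now rewrite (opposite_marked p q).
  - intros (q & Hq & Oq & Nq). split; auto. destruct Nq as [_ Vq].
    now rewrite (opposite_marked p q) in Vq.
Qed.

Lemma definable_far i j : def (fun e => far (e i) (e j)).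
Proof.
  apply definable_iff with
    (fun e => marks (e i) = true /\ exists q, D q /\ opposite (e i) q /\ near q (e j)).
  - intros e He. split.
    + intros [Mp H]. now apply far_iff.
    + intros H. pose proof H as [Mp _]. apply far_iff in H; auto.
  - definability.
Qed.
Local Hint Resolve definable_far : definable.

Definition nonneg p x := marks p = true /\ 0 <= v (marked p) x.

Lemma definable_nonneg i j : def (fun e => nonneg (e i) (e j)).
Proof.
  apply definable_iff with (fun e => marks (e i) = true /\
     forall k1, D k1 -> near (e i) k1 -> k1 <> one ->
     exists k, D k /\ near (e i) k /\ k <> one /\
       forall h, D h -> far (e i) h -> commute h k ->
         commute h k1 /\ exists h', D h' /\ mul (e j) h' = mul h (e j) /\ commute h' k).
  - intros e He. unfold nonneg. rewrite (nonneg_iff G (marked (e i)) (e j) (He j)).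
    unfold near, far. split; intros [Mp H]; (split; [exact Mp|]); intros k1 H1.
    + intros H2 H3. destruct (H k1 H1 (conj Mp H2) H3) as (k & K1 & [_ K2] & K3 & K4).
      exists k. repeat (split; [now auto|]). intros h Hh Vh. auto.
    + intros [_ H2] H3. destruct (H k1 H1 H2 H3) as (k & K1 & K2 & K3 & K4).
      exists k. repeat (split; [now auto|]). intros h Hh [_ Vh]. auto.
  - definability.
Qed.
Local Hint Resolve definable_nonneg : definable.

Definition sum p x y z := marks p = true /\ v (marked p) x + v (marked p) y = v (marked p) z.

(** Values at the marked end add under the group product, so x y and z may differ only by a factor
    [c] that is trivial at that end. *)
Lemma definable_sum i j k l : def (fun e => sum (e i) (e j) (e k) (e l)).
Proof.
  apply definable_iff with
    (fun e => exists c, D c /\ near (e i) c /\ mul (e j) (e k) = mul c (e l)).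
  - intros e He. unfold sum, near. split.
    + intros (c & Hc & [Mp Vc] & H). split; [auto|].
      rewrite <- val_mul, H, val_mul by auto. lia.
    + intros [Mp H].
      destruct (right_quotient (e l) (mul (e j) (e k))) as (c & Hc & Ec); auto.
      exists c. split; [auto|split; [split|]; auto].
      pose proof (val_mul (marked (e i)) c (e l) Hc (He l)) as H'.
      rewrite Ec, val_mul in H' by auto. lia.
  - definability.
Qed.
Local Hint Resolve definable_sum : definable.

Definition same p x y := marks p = true /\ v (marked p) x = v (marked p) y.

Lemma definable_same i j k : def (fun e => same (e i) (e j) (e k)).
Proof.
  apply definable_iff with (fun e => exists o, D o /\ o = one /\ sum (e i) (e j) o (e k)).
  - intros e He. unfold same, sum. split.
    + intros (o & Ho & -> & Mp & H). rewrite val_one in H. split; auto. lia.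
    + intros [Mp H]. exists one. rewrite val_one. split; [auto|split; [auto|split; [auto|lia]]].
  - definability.
Qed.
Local Hint Resolve definable_same : definable.

Definition same_far p x y := marks p = true /\ v (negb (marked p)) x = v (negb (marked p)) y.

Lemma definable_same_far i j k : def (fun e => same_far (e i) (e j) (e k)).
Proof.
  apply definable_iff with (fun e => exists q, D q /\ opposite (e i) q /\ same q (e j) (e k)).
  - intros e He. unfold same_far, same. split.
    + intros (q & Hq & Oq & Mq & H). split; [apply Oq|]. now rewrite (opposite_marked _ _ Oq) in H.
    + intros [Mp H]. destruct (opposite_ex _ Mp) as (q & Hq & Oq). exists q.
      split; [auto|split; [auto|split; [apply Oq|]]]. now rewrite (opposite_marked _ _ Oq).
  - definability.
Qed.
Local Hint Resolve definable_same_far : definable.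

Definition unit_at p x := marks p = true /\ v (marked p) x = 1.

(** 1 is the least positive value: subtracting it from any positive value leaves a nonnegative one.
    An element of value 1, given by [val_ex], rules out larger candidates. *)
Lemma definable_unit_at i j : def (fun e => unit_at (e i) (e j)).
Proof.
  apply definable_iff with (fun e => nonneg (e i) (e j) /\ ~ near (e i) (e j) /\
    forall y, D y -> nonneg (e i) y -> ~ near (e i) y ->
      exists z, D z /\ nonneg (e i) z /\ sum (e i) z (e j) y).
  - intros e He. unfold unit_at, nonneg, near, sum. split.
    + intros ([Mp H1] & H2 & H3). split; [auto|].
      destruct (val_ex (marked (e i)) 1) as (y & Hy & Vy).
      destruct (H3 y Hy) as (z & Hz & [_ Vz] & _ & H4).
      * split; auto. lia.
      * intros [_ H]. lia.
      * assert (v (marked (e i)) (e j) <> 0) by tauto. lia.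
    + intros [Mp H]. split; [split; [auto|lia]|]. split; [intros [_ H']; lia|].
      intros y Hy [_ H1] H2.
      destruct (right_quotient (e j) y) as (z & Hz & Ez); auto.
      exists z. pose proof (val_mul (marked (e i)) z (e j) Hz (He j)) as H'. rewrite Ez in H'.
      assert (v (marked (e i)) y <> 0) by tauto.
      split; [auto|split; (split; [auto|lia])].
  - definability.
Qed.
Local Hint Resolve definable_unit_at : definable.

(** Value 0 needs a case of its own: a rigid element that is trivial at an end commutes with itself
    and is therefore [one]. The far value shared by [w] and [x'] stays unspecified, since it
    cancels. *)
Definition product p x y z :=
  (near p x /\ near p z) \/
  exists w, D w /\ exists u, D u /\ exists x', D x' /\ exists y', D y' /\
    (rigid w /\ unit_at p w /\ commute w u /\ same p u y) /\
    (rigid x' /\ same p x' x /\ same_far p x' w) /\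
    commute x' y' /\ same p y' z /\ same_far p y' u.

Lemma definable_product i j k l : def (fun e => product (e i) (e j) (e k) (e l)).
Proof. unfold product. definability. Qed.

(* If w has values (1, b), u has values (y, y b), x' has values (x, b) and y' has
   values (z, y b), then commutation of x' and y' says x (y b) = z b. *)
Lemma product_iff p x y z : D x -> D y -> D z -> marks p = true -> 0 <= v (marked p) x ->
  (product p x y z <-> v (marked p) x * v (marked p) y = v (marked p) z).
Proof.
  intros Hx Hy Hz Mp Px. unfold product, near, unit_at, same, same_far. split.
  - intros [[[_ H1] [_ H2]]|(w & Hw & u & Hu & x' & Hx' & y' & Hy' &
      (Rw & [_ Vw] & Cw & _ & Vu) & (Rx & [_ Vx] & _ & Fx) & Cx & [_ Vy] & _ & Fy)].
    { rewrite H1, H2. lia. }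
    pose proof (rigid_proportional (marked p) w u Hw Hu Rw Cw) as E1.
    pose proof (rigid_proportional (marked p) x' y' Hx' Hy' Rx Cx) as E2.
    assert (B : v (negb (marked p)) w <> 0).
    { intros B. assert (w = one).
      { apply Rw; [auto|reflexivity|]. unfold thin. destruct (marked p); auto. }
      subst w. rewrite val_one in Vw. discriminate. }
    rewrite Vw, Vu, Z.mul_1_l in E1. rewrite Vx, Vy, Fx, Fy, E1 in E2.
    apply Z.mul_reg_r with (v (negb (marked p)) w); auto. lia.
  - intros E. destruct (Z.eq_dec (v (marked p) x) 0) as [E0|E0].
    { left. rewrite E0 in *. split; split; (auto || lia). }
    right.
    destruct (rigid_ex G (marked p) 1) as (w & Hw & Rw & Vw & Fw); [lia|].
    destruct (rigid_ex G (marked p) (v (marked p) x)) as (x' & Hx' & Rx & Vx & Fx); [lia|].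
    destruct (power_ex w (v (marked p) y) Hw) as (u & Hu & Vu & Cu).
    destruct (power_ex x' (v (marked p) y) Hx') as (y' & Hy' & Vy & Cy).
    exists w. split; [auto|]. exists u. split; [auto|].
    exists x'. split; [auto|]. exists y'. split; [auto|].
    rewrite !Vu, !Vy, Vw, Vx, Fw, Fx.
    assert (commute w u) by (apply commute_sym, Cu; reflexivity).
    assert (commute x' y') by (apply commute_sym, Cy; reflexivity).
    repeat split; auto; lia.
Qed.

(** The inverse [w'] is there to say that w has value -1 at the other end, because only the value 1
    has a defining formula so far. *)
Definition transfer p x q y :=
  exists w, D w /\ exists w', D w' /\ exists u, D u /\ exists s, D s /\
    (rigid w /\ unit_at p w /\ mul w w' = one /\ unit_at q w') /\
    commute w u /\ same p u x /\ mul u y = s /\ near q s.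

Lemma definable_mul_one i j : def (fun e => mul (e i) (e j) = one).
Proof.
  apply definable_iff with (fun e => exists o, D o /\ o = one /\ mul (e i) (e j) = o).
  - intros e He. split; [intros (o & _ & -> & H); auto|eauto].
  - definability.
Qed.
Local Hint Resolve definable_mul_one : definable.

Lemma definable_transfer i j k l : def (fun e => transfer (e i) (e j) (e k) (e l)).
Proof. unfold transfer. definability. Qed.

(* The rigid w of values (1, -1) carries u = w^n, of values (n, -n), and u y is
   trivial at the other end if and only if y has value n there. *)
Lemma transfer_iff p x q y : D x -> D y -> opposite p q ->
  (transfer p x q y <-> v (marked p) x = v (marked q) y).
Proof.
  intros Hx Hy O. pose proof O as (Mp & Mq & _). apply opposite_marked in O.
  unfold transfer, unit_at, same, near. rewrite O. split.
  - intros (w & Hw & w' & Hw' & u & Hu & s & Hs & (Rw & [_ Vw] & Iw & _ & Fw) & C & [_ Vu] & Es & _ & Vs).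
    pose proof (rigid_proportional (marked p) w u Hw Hu Rw C) as E.
    rewrite <- Es, val_mul in Vs by auto.
    pose proof (val_inv (negb (marked p)) w w' Hw Hw' Iw). rewrite Vw, Vu in E. lia.
  - intros E.
    destruct (rigid_ex G (marked p) 1) as (w & Hw & Rw & Vw & Fw); [lia|].
    destruct (inv_mem G w Hw) as (w' & Hw' & I1 & I2).
    destruct (power_ex w (v (marked p) x) Hw) as (u & Hu & Vu & Cu).
    exists w. split; [auto|]. exists w'. split; [auto|]. exists u. split; [auto|].
    exists (mul u y). split; [auto|].
    rewrite val_mul, !Vu, Vw, Fw, (val_inv _ w w') by auto. rewrite Fw.
    assert (commute w u) by (apply commute_sym, Cu; reflexivity).
    repeat split; auto; lia.
Qed.
Local Hint Resolve definable_transfer definable_product : definable.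

(* Junk codes, with p marking no end or with a negative value, stand for 0, so that
   every pair is a code. *)
Definition decode p x : nat := if marks p then Z.to_nat (v (marked p) x) else 0%nat.

Definition positive p x := nonneg p x /\ ~ near p x.

Lemma positive_iff p x : positive p x <-> marks p = true /\ 0 < v (marked p) x.
Proof.
  unfold positive, nonneg, near. split.
  - intros [[H1 H2] H3]. split; [auto|]. assert (v (marked p) x <> 0) by tauto. lia.
  - intros [H1 H2]. split; [split; [auto|lia]|]. intros [_ H]. lia.
Qed.

Lemma decode_positive p x : positive p x -> Z.of_nat (decode p x) = v (marked p) x.
Proof. rewrite positive_iff. intros [H1 H2]. unfold decode. rewrite H1. lia. Qed.

Lemma decode_nonpositive p x : ~ positive p x -> decode p x = 0%nat.
Proof.
  rewrite positive_iff. unfold decode. destruct (marks p); auto. intros H.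
  assert (~ 0 < v (marked p) x) by tauto. lia.
Qed.

Lemma decode_nonneg p x : nonneg p x -> Z.of_nat (decode p x) = v (marked p) x.
Proof. intros [H1 H2]. unfold decode. rewrite H1. lia. Qed.

Lemma decode_surj e n : exists p, D p /\ exists x, D x /\ nonneg p x /\ marked p = e /\ decode p x = n.
Proof.
  destruct (marks_ex e) as (p & Hp & Mp & Ep). exists p. split; [auto|].
  destruct (val_ex e (Z.of_nat n)) as (x & Hx & Vx). exists x. split; [auto|].
  unfold nonneg, decode. rewrite Mp, Ep, Vx. repeat split; lia.
Qed.

Lemma definable_decode_eq i j k l : def (fun e => decode (e i) (e j) = decode (e k) (e l)).
Proof.
  (* Codes that are not positive, junk included, all decode to 0. Positive codes are compared by
     [same] if they sit at one end and by [transfer] otherwise. *)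
  apply definable_iff with (fun e =>
    (~ positive (e i) (e j) /\ ~ positive (e k) (e l)) \/
    (positive (e i) (e j) /\ positive (e k) (e l) /\
      ((near (e i) (e k) /\ same (e i) (e j) (e l)) \/
       (~ near (e i) (e k) /\ transfer (e i) (e j) (e k) (e l))))).
  - intros e He.
    destruct (classic (positive (e i) (e j))) as [P1|P1];
    destruct (classic (positive (e k) (e l))) as [P2|P2].
    + pose proof (decode_positive _ _ P1) as E1. pose proof (decode_positive _ _ P2) as E2.
      assert (E : decode (e i) (e j) = decode (e k) (e l) <->
              v (marked (e i)) (e j) = v (marked (e k)) (e l)) by lia.
      rewrite E. pose proof P1 as [[M1 _] _]. pose proof P2 as [[M2 _] _].
      destruct (classic (near (e i) (e k))) as [N|N].
      * assert (Em : marked (e k) = marked (e i)) by (apply near_marked; auto).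
        unfold same. rewrite Em. tauto.
      * rewrite transfer_iff by (auto; split; auto). tauto.
    + pose proof (decode_positive _ _ P1) as E1. rewrite (decode_nonpositive _ _ P2).
      apply positive_iff in P1 as P1'. split; [tauto|lia].
    + pose proof (decode_positive _ _ P2) as E1. rewrite (decode_nonpositive _ _ P1).
      apply positive_iff in P2 as P2'. split; [tauto|lia].
    + rewrite !decode_nonpositive by auto. tauto.
  - unfold positive. definability.
Qed.
Local Hint Resolve definable_decode_eq : definable.

Definition arith_graph (b : bool) p x y z := if b then sum p x y z else product p x y z.

(** [sum] and [product] relate values at a single end, whereas the three codes may use different
    ends; so all three numbers are coded anew at a common end [p]. *)
Lemma definable_decode_op b i1 j1 i2 j2 i3 j3 :
  def (fun e => arith_op b (decode (e i1) (e j1)) (decode (e i2) (e j2)) = decode (e i3) (e j3)).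
Proof.
  apply definable_iff with (fun e => exists p, D p /\ exists z1, D z1 /\ exists z2, D z2 /\
    exists z3, D z3 /\ (nonneg p z1 /\ nonneg p z2 /\ nonneg p z3) /\
      decode p z1 = decode (e i1) (e j1) /\ decode p z2 = decode (e i2) (e j2) /\
      decode p z3 = decode (e i3) (e j3) /\ arith_graph b p z1 z2 z3).
  - intros e He.
    assert (K : forall p z1 z2 z3, D z1 -> D z2 -> D z3 -> nonneg p z1 -> nonneg p z2 -> nonneg p z3 ->
       (arith_graph b p z1 z2 z3 <-> arith_op b (decode p z1) (decode p z2) = decode p z3)).
    { intros p z1 z2 z3 D1 D2 D3 P1 P2 P3.
      apply decode_nonneg in P1 as E1. apply decode_nonneg in P2 as E2. apply decode_nonneg in P3 as E3.
      destruct P1 as [Mp P1]. destruct b; simpl.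
      - unfold sum. rewrite <- E1, <- E2, <- E3. split; [intros [_ H]; lia|intros H; split; [auto|lia]].
      - rewrite product_iff, <- E1, <- E2, <- E3 by auto. lia. }
    split.
    + intros (p & Hp & z1 & D1 & z2 & D2 & z3 & D3 & (P1 & P2 & P3) & <- & <- & <- & H).
      now apply K in H.
    + intros H.
      destruct (decode_surj true (decode (e i1) (e j1))) as (p & Hp & z1 & D1 & [Mp N1] & Ep & E1).
      destruct (val_ex true (Z.of_nat (decode (e i2) (e j2)))) as (z2 & D2 & V2).
      destruct (val_ex true (Z.of_nat (decode (e i3) (e j3)))) as (z3 & D3 & V3).
      assert (P2 : nonneg p z2) by (split; [auto|rewrite Ep; lia]).
      assert (P3 : nonneg p z3) by (split; [auto|rewrite Ep; lia]).
      assert (E2 : decode p z2 = decode (e i2) (e j2)) by (apply decode_nonneg in P2; rewrite Ep in P2; lia).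
      assert (E3 : decode p z3 = decode (e i3) (e j3)) by (apply decode_nonneg in P3; rewrite Ep in P3; lia).
      exists p. split; [auto|]. exists z1. split; [auto|]. exists z2. split; [auto|].
      exists z3. split; [auto|].
      split; [split; [split|]; auto|].
      split; [auto|split; [auto|split; [auto|]]].
      apply K; auto; [split; auto|]. now rewrite E1, E2, E3.
  - destruct b; unfold arith_graph; definability.
Qed.
Local Hint Resolve definable_decode_op : definable.

(** * Translation of arithmetic formulas *)

Definition decode_env (y : nat -> M) (j : nat) : nat := decode (y (j * 2)%nat) (y (j * 2 + 1)%nat).

Fixpoint term_bound (t : term bool) : nat :=
  match t with Var i => Datatypes.S i | App _ t1 t2 => max (term_bound t1) (term_bound t2) end.

Fixpoint formula_bound (psi : formula bool) : nat :=
  match psi with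
  | FEq t1 t2 => max (term_bound t1) (term_bound t2)
  | FNeg p => formula_bound p
  | FAnd p q => max (formula_bound p) (formula_bound q)
  | FEx _ p => formula_bound p
  end.

Lemma eval_ext (e e' : nat -> nat) t :
  (forall j, (j < term_bound t)%nat -> e j = e' j) -> eval arith_op e t = eval arith_op e' t.
Proof.
  induction t as [i|s t1 IH1 t2 IH2]; simpl; intros H; [apply H; lia|].
  rewrite IH1, IH2; auto; intros; apply H; lia.
Qed.

Lemma sat_ext psi : forall e e' : nat -> nat,
  (forall j, (j < formula_bound psi)%nat -> e j = e' j) ->
  (sat arith_univ arith_op e psi <-> sat arith_univ arith_op e' psi).
Proof.
  induction psi as [t1 t2|p IH|p IHp q IHq|i p IH]; simpl; intros e e' H.
  - rewrite (eval_ext e e' t1), (eval_ext e e' t2) by (intros; apply H; lia). tauto.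
  - rewrite (IH e e' H). tauto.
  - rewrite (IHp e e'), (IHq e e') by (intros; apply H; lia). tauto.
  - assert (K : forall a, sat arith_univ arith_op (upd e i a) p <-> sat arith_univ arith_op (upd e' i a) p).
    { intros a. apply IH. intros j Hj. unfold upd. destruct (Nat.eqb j i); auto. }
    split; intros (a & Ha & Hs); exists a; split; auto; now apply K.
Qed.

Lemma decode_env_upd2 y k a b :
  decode_env (upd (upd y (k * 2) a) (k * 2 + 1) b) = upd (decode_env y) k (decode a b).
Proof.
  apply functional_extensionality. intros j. unfold decode_env.
  destruct (Nat.eq_dec j k) as [->|Hj].
  - rewrite upd_same, (upd_other _ (k * 2 + 1)), !upd_same by lia. reflexivity.
  - rewrite !upd_other by lia. reflexivity.
Qed.

Lemma eval_decode_upd y m a t : (term_bound t * 2 <= m)%nat ->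
  eval arith_op (decode_env (upd y m a)) t = eval arith_op (decode_env y) t.
Proof.
  intros H. apply eval_ext. intros j Hj. unfold decode_env. rewrite !upd_other by lia. reflexivity.
Qed.

Lemma definable_eval_decode t : forall i j,
  def (fun y => eval arith_op (decode_env y) t = decode (y i) (y j)).
Proof.
  induction t as [n|s t1 IH1 t2 IH2]; intros i j; [apply definable_decode_eq|].
  apply definable_iff with (fun y => exists p1, D p1 /\ exists x1, D x1 /\ exists p2, D p2 /\ exists x2, D x2 /\
     eval arith_op (decode_env y) t1 = decode p1 x1 /\ eval arith_op (decode_env y) t2 = decode p2 x2 /\
     arith_op s (decode p1 x1) (decode p2 x2) = decode (y i) (y j)).
  - intros e He. simpl. split.
    + intros (p1 & _ & x1 & _ & p2 & _ & x2 & _ & -> & -> & H). exact H.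
    + intros H.
      destruct (decode_surj true (eval arith_op (decode_env e) t1)) as (p1 & P1 & x1 & X1 & _ & _ & E1).
      destruct (decode_surj true (eval arith_op (decode_env e) t2)) as (p2 & P2 & x2 & X2 & _ & _ & E2).
      exists p1. split; [auto|]. exists x1. split; [auto|]. exists p2. split; [auto|]. exists x2.
      rewrite E1, E2. auto.
  (* [B] brings a bound on the variables hidden in the two terms into the context, where [nat_bound]
     picks it up. The new indices then lie beyond every coordinate that [decode_env] reads for these
     terms. *)
  - assert (exists B, term_bound t1 * 2 + term_bound t2 * 2 <= B)%nat as [B HB] by (eexists; apply le_n).
    do 4 ((let N := nat_bound 0%nat in apply (definable_ex _ _ N)); intros ? ?; split;
      [ | intros; cbv beta; rewrite !eval_decode_upd, ?upd_other by lia; reflexivity]).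
    repeat apply definable_and; auto with definable.
Qed.

Lemma decode_env_ex (P : nat -> Prop) :
  (exists n, P n) <-> exists a, D a /\ exists b, D b /\ P (decode a b).
Proof.
  split.
  - intros [n Hn]. destruct (decode_surj true n) as (a & Ha & b & Hb & _ & _ & E).
    exists a. split; [auto|]. exists b. split; [auto|]. now rewrite E.
  - intros (a & _ & b & _ & H). eauto.
Qed.

(** A quantifier over numbers at index k becomes two group quantifiers at 2k and 2k + 1. This is
    exact because each pair decodes to a number and each number has a code. *)
Lemma definable_sat_decode psi : def (fun y => sat arith_univ arith_op (decode_env y) psi).
Proof.
  induction psi as [t1 t2|p IH|p IHp q IHq|k p IH]; simpl.
  - apply definable_iff with (fun y => exists a, D a /\ exists b, D b /\ eval arith_op (decode_env y) t1 = decode a b /\ eval arith_op (decode_env y) t2 = decode a b).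
    + intros y _. rewrite <- (decode_env_ex (fun n => eval arith_op (decode_env y) t1 = n /\
                                               eval arith_op (decode_env y) t2 = n)).
      split; [intros (n & -> & ->); auto|eauto].
    + assert (exists B, term_bound t1 * 2 + term_bound t2 * 2 <= B)%nat as [B HB] by (eexists; apply le_n).
      do 2 ((let N := nat_bound 0%nat in apply (definable_ex _ _ N)); intros ? ?; split;
        [ | intros; cbv beta; rewrite !eval_decode_upd, ?upd_other by lia; reflexivity]).
      apply definable_and; apply definable_eval_decode.
  - now apply definable_not.
  - now apply definable_and.
  - refine (definable_iff _ _ _ _ _
      (definable_upd_ex _ _ _ (k * 2)%nat (definable_upd_ex _ _ _ (k * 2 + 1)%nat IH))).
    intros y _. unfold arith_univ.
    transitivity (exists n, sat arith_univ arith_op (upd (decode_env y) k n) p).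
    + rewrite (decode_env_ex (fun n => sat arith_univ arith_op (upd (decode_env y) k n) p)).
      setoid_rewrite decode_env_upd2. reflexivity.
    + split; [intros (n & H); eauto|intros (n & _ & H); eauto].
Qed.

(* The assignments that occur here agree with the decoded one below k only; the
   remaining free variables are universally quantified, one at a time. *)
Lemma definable_sat_prefix psi d : forall k, (formula_bound psi <= k + d)%nat ->
  def (fun y => forall e : nat -> nat, (forall j, (j < k)%nat -> e j = decode_env y j) ->
                  sat arith_univ arith_op e psi).
Proof.
  induction d as [|d IH]; intros k Hk.
  - refine (definable_iff _ _ _ _ _ (definable_sat_decode psi)).
    intros y _. split.
    + intros H e He. revert H. apply sat_ext. intros j Hj. apply He. lia.
    + intros H. apply H. auto.
  - assert (HS : (formula_bound psi <= Datatypes.S k + d)%nat) by lia.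
    refine (definable_iff _ _ _ _ _ (definable_not _ _ _
      (definable_upd_ex _ _ _ (k * 2)%nat (definable_upd_ex _ _ _ (k * 2 + 1)%nat
        (definable_not _ _ _ (IH _ HS)))))).
    intros y _. cbv beta. split.
    + intros H e He. apply NNPP. intros Hn. apply H.
      destruct (decode_surj true (e k)) as (a & Ha & b & Hb & _ & _ & E).
      exists a. split; [auto|]. exists b. split; [auto|]. rewrite decode_env_upd2, E.
      intros H'. apply Hn, H'. intros j Hj.
      destruct (Nat.eq_dec j k) as [->|Hjk]; [now rewrite upd_same|].
      rewrite upd_other by auto. apply He. lia.
    + intros H (a & _ & b & _ & H'). rewrite decode_env_upd2 in H'. apply H'.
      intros e He. apply H. intros j Hj. rewrite He, upd_other by lia. reflexivity.
Qed.

Theorem two_ended_interprets_arith : interprets_arith D op.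
Proof.
  exists 2%nat, (fun y => D (y 0%nat) /\ D (y 1%nat)), (fun y => decode (y 0%nat) (y 1%nat)).
  split; [|split; [|split]].
  - intros y y' H. rewrite !H by lia. tauto.
  - intros y [H0 H1] [|[|i]] Hi; auto; lia.
  - intros n. destruct (decode_surj true n) as (p & Hp & x & Hx & _ & _ & E).
    exists (fun i => if Nat.eqb i 0 then p else x). simpl. auto.
  - intros k psi. refine (definable_iff _ _ _ _ _ (definable_sat_prefix psi (formula_bound psi) k _)).
    + intros y Hy. unfold block, decode_env. setoid_rewrite Nat.add_0_r.
      split; [intros H; split; auto|intros [_ H]; exact H].
    + lia.
Qed.

End TwoEnded.

(** * Piecewise affine homeomorphisms *)

Section PiecewiseAffine.
Local Open Scope R_scope.
Context (r g : R) (Lam A : R -> Prop).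
Hypothesis r_pos : 0 < r.
Hypothesis g_pos : 0 < g.
Hypothesis g_lt1 : g < 1.
Hypothesis Lam_iff : forall l, Lam l <-> exists z : Z, l = powerRZ g z.
Hypothesis A_zero : A 0.
Hypothesis A_add : forall a b, A a -> A b -> A (a + b).
Hypothesis A_opp : forall a, A a -> A (- a).
Hypothesis A_r : A r.
Hypothesis A_scale : forall l a, Lam l -> A a -> A (l * a).
Local Hint Resolve A_zero A_add A_opp A_r A_scale : core.

Lemma A_sub a b : A a -> A b -> A (a - b).
Proof. intros. unfold Rminus. auto. Qed.
Local Hint Resolve A_sub : core.

Lemma powerRZ_pos z : 0 < powerRZ g z.
Proof. now apply powerRZ_lt. Qed.

Lemma powerRZ_plus m n : powerRZ g (m + n) = powerRZ g m * powerRZ g n.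
Proof. apply powerRZ_add. lra. Qed.

Lemma powerRZ_lt1 m : (0 < m)%Z -> powerRZ g m < 1.
Proof.
  destruct m as [|p|p]; intros H; try lia. simpl.
  apply pow_lt_1_compat; [lra|lia].
Qed.

Lemma powerRZ_decr m n : (m < n)%Z -> powerRZ g n < powerRZ g m.
Proof.
  intros H. replace n with (m + (n - m))%Z by lia. rewrite powerRZ_plus.
  pose proof (powerRZ_pos m).
  assert (powerRZ g (n - m) < 1) by (apply powerRZ_lt1; lia). nra.
Qed.

Lemma powerRZ_inj m n : powerRZ g m = powerRZ g n -> m = n.
Proof.
  intros H. destruct (Z.lt_total m n) as [L|[E|L]]; auto;
    apply powerRZ_decr in L; lra.
Qed.

Lemma Lam_pos l : Lam l -> 0 < l.
Proof. rewrite Lam_iff. intros [z ->]. apply powerRZ_pos. Qed.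

Lemma Lam_powerRZ z : Lam (powerRZ g z).
Proof. apply Lam_iff. eauto. Qed.

Lemma Lam_one : Lam 1.
Proof. exact (Lam_powerRZ 0). Qed.

Lemma Lam_mul l m : Lam l -> Lam m -> Lam (l * m).
Proof.
  rewrite !Lam_iff. intros [x ->] [y ->]. exists (x + y)%Z. now rewrite powerRZ_plus.
Qed.

Lemma Lam_inv l : Lam l -> Lam (/ l).
Proof.
  rewrite !Lam_iff. intros [x ->]. exists (- x)%Z. now rewrite powerRZ_neg'.
Qed.
Local Hint Resolve Lam_pos Lam_powerRZ Lam_one Lam_mul Lam_inv : core.

(** Pieces are closed and neighbours share an endpoint, which builds continuity in. Pieces of length
    0 are allowed, so that splitting at a point needs no case distinction. *)
Inductive PL (x : R -> R) : R -> R -> Prop :=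
| PL_affine a b l : a <= b -> A a -> A b -> A (x a) -> Lam l ->
    (forall t, a <= t <= b -> x t = x a + l * (t - a)) -> PL x a b
| PL_cat a c b : PL x a c -> PL x c b -> PL x a b.

Lemma PL_le x a b : PL x a b -> a <= b.
Proof. induction 1; lra. Qed.

Lemma PL_mem x a b : PL x a b -> A a /\ A b /\ A (x a) /\ A (x b).
Proof.
  induction 1 as [a b l Hab Ha Hb Hxa Hl Hx|a c b _ (?&?&?&?) _ (?&?&?&?)]; auto.
  repeat split; auto. rewrite (Hx b) by lra. auto.
Qed.

Lemma PL_incr x a b : PL x a b -> forall s t, a <= s -> s < t -> t <= b -> x s < x t.
Proof.
  induction 1 as [a b l Hab Ha Hb Hxa Hl Hx|a c b H1 IH1 H2 IH2]; intros s t Hs Hst Ht.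
  - rewrite (Hx s), (Hx t) by lra. apply Lam_pos in Hl. nra.
  - destruct (Rle_dec t c); [apply IH1; lra|].
    destruct (Rle_dec c s); [apply IH2; lra|].
    apply Rlt_trans with (x c); [apply IH1|apply IH2]; lra.
Qed.

Lemma PL_incr_le x a b s t : PL x a b -> a <= s -> s <= t -> t <= b -> x s <= x t.
Proof.
  intros H Hs [Hst| ->] Ht; [|lra]. apply Rlt_le. eapply PL_incr; eauto.
Qed.

Lemma PL_lipschitz x a b : PL x a b ->
  exists K, 0 < K /\ forall s t, a <= s -> s <= t -> t <= b -> x t - x s <= K * (t - s).
Proof.
  induction 1 as [a b l Hab Ha Hb Hxa Hl Hx|a c b H1 (K1 & P1 & IH1) H2 (K2 & P2 & IH2)].
  - exists l. split; auto. intros s t Hs Hst Ht. rewrite (Hx s), (Hx t) by lra. lra.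
  - exists (Rmax K1 K2). pose proof (Rmax_l K1 K2). pose proof (Rmax_r K1 K2).
    split; [lra|]. intros s t Hs Hst Ht.
    destruct (Rle_dec t c) as [C|C].
    { pose proof (IH1 s t Hs Hst C). nra. }
    destruct (Rle_dec c s) as [C'|C'].
    { pose proof (IH2 s t C' Hst Ht). nra. }
    assert (x c - x s <= K1 * (c - s)) by (apply IH1; lra).
    assert (x t - x c <= K2 * (t - c)) by (apply IH2; lra). nra.
Qed.

Lemma PL_surj x a b : PL x a b -> forall s, x a <= s <= x b -> exists t, a <= t <= b /\ x t = s.
Proof.
  induction 1 as [a b l Hab Ha Hb Hxa Hl Hx|a c b H1 IH1 H2 IH2]; intros s Hs.
  - pose proof (Lam_pos l Hl) as Pl. exists (a + (s - x a) / l).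
    assert (E : l * ((s - x a) / l) = s - x a) by (field; lra).
    rewrite (Hx b) in Hs by lra.
    assert (a <= a + (s - x a) / l <= b) by (split; nra).
    split; auto. rewrite Hx by auto. lra.
  - pose proof (PL_le _ _ _ H1). pose proof (PL_le _ _ _ H2).
    destruct (Rle_dec s (x c)).
    + destruct (IH1 s) as (t & Ht & E); [lra|]. exists t. split; auto. lra.
    + destruct (IH2 s) as (t & Ht & E); [lra|]. exists t. split; auto. lra.
Qed.

Lemma PL_split x a b c : PL x a b -> a <= c <= b -> A c -> PL x a c /\ PL x c b.
Proof.
  intros H. revert c.
  induction H as [a b l Hab Ha Hb Hxa Hl Hx|a d b H1 IH1 H2 IH2]; intros c Hc Ac.
  - assert (A (x c)) by (rewrite Hx by auto; auto).
    split; apply PL_affine with l; auto; try lra; intros t Ht.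
    + apply Hx. lra.
    + rewrite (Hx t), (Hx c) by lra. ring.
  - destruct (Rle_dec c d).
    + destruct (IH1 c) as [? ?]; auto; [lra|]. split; auto. now apply PL_cat with d.
    + destruct (IH2 c) as [? ?]; auto; [lra|]. split; auto. now apply PL_cat with d.
Qed.

Lemma PL_comp_affine x y p q : PL y p q -> forall a b l, a <= b -> A a -> A b -> Lam l ->
  x a = p -> x b = q -> (forall t, a <= t <= b -> x t = x a + l * (t - a)) ->
  PL (fun t => y (x t)) a b.
Proof.
  induction 1 as [p q m Hpq Hp Hq Hyp Hm Hy|p c q H1 IH1 H2 IH2];
    intros a b l Hab Ha Hb Hl Ep Eq Hx; pose proof (Lam_pos l Hl) as Pl.
  - apply PL_affine with (m * l); auto; [now rewrite Ep|].
    intros t Ht. rewrite (Hy (x t)), Ep, (Hx t), Ep by (rewrite <- ?Ep, <- ?Eq, ?(Hx t), ?(Hx b) by lra; nra).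
    ring.
  (* The breakpoint c of y is pulled back through x; it stays in A because Lambda contains the
     inverse of l. *)
  - set (d := a + / l * (c - p)).
    assert (Ed : l * (d - a) = c - p) by (unfold d; field; lra).
    pose proof (PL_le _ _ _ H1). pose proof (PL_le _ _ _ H2).
    pose proof (proj1 (PL_mem _ _ _ H1)). pose proof (proj1 (PL_mem _ _ _ H2)).
    assert (Hd : a <= d <= b) by (rewrite (Hx b) in Eq by lra; split; nra).
    assert (A d) by (unfold d; auto).
    assert (Exd : x d = c) by (rewrite Hx by auto; lra).
    apply PL_cat with d.
    + apply IH1 with l; auto; try lra. intros t Ht. apply Hx. lra.
    + apply IH2 with l; auto; try lra. intros t Ht. rewrite (Hx t), (Hx d) by lra. ring.
Qed.

Lemma PL_comp x y a b : PL x a b -> PL y (x a) (x b) -> PL (fun t => y (x t)) a b.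
Proof.
  induction 1 as [a b l Hab Ha Hb Hxa Hl Hx|a c b H1 IH1 H2 IH2]; intros Hy.
  - apply PL_comp_affine with (x a) (x b) l; auto.
  - destruct (PL_split y (x a) (x b) (x c)) as [Y1 Y2]; auto.
    + split.
      * apply (PL_incr_le x a c); auto; try lra. now apply PL_le in H1.
      * apply (PL_incr_le x c b); auto; try lra. now apply PL_le in H2.
    + apply (PL_mem _ _ _ H2).
    + apply PL_cat with c; auto.
Qed.

Lemma PL_inv x y a b : PL x a b -> (forall t, a <= t <= b -> y (x t) = t) -> PL y (x a) (x b).
Proof.
  induction 1 as [a b l Hab Ha Hb Hxa Hl Hx|a c b H1 IH1 H2 IH2]; intros Hy.
  - pose proof (Lam_pos l Hl) as Pl.
    apply PL_affine with (/ l); auto.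
    + rewrite (Hx b) by lra. nra.
    + rewrite (Hx b) by lra. auto.
    + rewrite Hy by lra. auto.
    + intros s Hs. rewrite (Hy a) by lra.
      destruct (PL_surj x a b) with s as (t & Ht & <-); auto; [now apply PL_affine with l|].
      rewrite Hy, Hx by auto. field. lra.
  - pose proof (PL_le _ _ _ H1). pose proof (PL_le _ _ _ H2).
    apply PL_cat with (x c); [apply IH1|apply IH2]; intros; apply Hy; lra.
Qed.

(** Conjugation by the flip t -> r - t. It preserves slopes and exchanges the ends, so statements
    about r are deduced from statements about 0. *)
Definition reflect (x : R -> R) : R -> R := fun t => r - x (r - t).

Lemma PL_reflect x a b : PL x a b -> PL (reflect x) (r - b) (r - a).
Proof.
  induction 1 as [a b l Hab Ha Hb Hxa Hl Hx|a c b H1 IH1 H2 IH2].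
  - unfold reflect. apply PL_affine with l; auto; try lra.
    + replace (r - (r - b)) with b by ring. rewrite (Hx b) by lra. auto.
    + intros t Ht. replace (r - (r - b)) with b by ring.
      rewrite (Hx (r - t)), (Hx b) by lra. ring.
  - now apply PL_cat with (r - c).
Qed.

Lemma PL_germ x a b p : PL x a b -> a <= p < b ->
  exists l eps, Lam l /\ 0 < eps /\ forall t, p <= t <= p + eps -> x t = x p + l * (t - p).
Proof.
  intros H. induction H as [a b l Hab Ha Hb Hxa Hl Hx|a c b H1 IH1 H2 IH2]; intros Hp.
  - exists l, (b - p). split; [auto|split; [lra|]]. intros t Ht.
    rewrite (Hx t), (Hx p) by lra. ring.
  - destruct (Rlt_dec p c); [apply IH1|apply IH2]; lra.
Qed.

Lemma PL_pieces x a b : PL x a b -> a < b ->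
  exists (n : nat) (c lam d : nat -> R), c 0%nat = a /\ c n = b /\
    forall i, (i < n)%nat -> c i < c (S i) /\ A (c i) /\ A (x (c i)) /\ Lam (lam i) /\
      forall t, c i <= t <= c (S i) -> x t = lam i * t + d i.
Proof.
  induction 1 as [a b l Hab Ha Hb Hxa Hl Hx|a c b H1 IH1 H2 IH2]; intros Hlt.
  - exists 1%nat, (fun i => match i with O => a | _ => b end), (fun _ => l), (fun _ => x a - l * a).
    split; [auto|split; [auto|]]. intros [|i] Hi; [|lia].
    repeat split; auto. intros t Ht. rewrite Hx by auto. ring.
  - pose proof (PL_le _ _ _ H1) as L1. pose proof (PL_le _ _ _ H2) as L2.
    (* Pieces of length 0 are dropped here, because the breakpoints must increase strictly. *)
    destruct L1 as [L1| <-]; [|auto]. destruct L2 as [L2| ->]; [|auto].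
    destruct (IH1 L1) as (n1 & c1 & l1 & d1 & S1 & E1 & P1).
    destruct (IH2 L2) as (n2 & c2 & l2 & d2 & S2 & E2 & P2).
    pose (join := fun (u w : nat -> R) i => if Nat.ltb i n1 then u i else w (i - n1)%nat).
    assert (J1 : forall u w i, (i < n1)%nat -> join u w i = u i).
    { intros u w i Hi. unfold join. now rewrite (proj2 (Nat.ltb_lt i n1) Hi). }
    assert (J2 : forall u w i, (n1 <= i)%nat -> join u w i = w (i - n1)%nat).
    { intros u w i Hi. unfold join. now rewrite (proj2 (Nat.ltb_ge i n1) Hi). }
    assert (J3 : forall i, (i <= n1)%nat -> join c1 c2 i = c1 i).
    { intros i Hi. destruct (Nat.eq_dec i n1) as [->|Hn]; [|apply J1; lia].
      rewrite J2, Nat.sub_diag by lia. congruence. }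
    exists (n1 + n2)%nat, (join c1 c2), (join l1 l2), (join d1 d2).
    split; [rewrite J3; auto; lia|]. split.
    { rewrite J2 by lia. now replace (n1 + n2 - n1)%nat with n2 by lia. }
    intros i Hi. destruct (Nat.lt_ge_cases i n1) as [Hin|Hin].
    + rewrite !(J1 _ _ i), J3 by lia. auto.
    + rewrite !J2 by lia. replace (S i - n1)%nat with (S (i - n1)) by lia. apply P2. lia.
Qed.

(* The elements of [inF], extended by the fixed point [r]: increasing homeomorphisms of
   the line. *)
Definition PLF (x : R -> R) : Prop := (forall t, t <= 0 \/ r <= t -> x t = t) /\ PL x 0 r.

Lemma PLF_incr x : PLF x -> forall s t, s < t -> x s < x t.
Proof.
  intros [Hid HP] s t Hst.
  assert (E0 : x 0 = 0) by (apply Hid; lra). assert (Er : x r = r) by (apply Hid; lra).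
  destruct (Rle_dec t 0); [rewrite !Hid by lra; lra|].
  destruct (Rle_dec r s); [rewrite !Hid by lra; lra|].
  assert (x s <= x (Rmax s 0) /\ (s < 0 -> x s < 0)) as [Hs1 Hs2].
  { split.
    - unfold Rmax. destruct (Rle_dec s 0); [rewrite (Hid s), E0 by lra; lra|lra].
    - intros. rewrite Hid by lra. lra. }
  destruct (Rle_dec 0 s).
  - destruct (Rle_dec t r); [apply (PL_incr x 0 r); auto|].
    rewrite (Hid t) by lra. assert (x s < x r) by (apply (PL_incr x 0 r); auto; lra). lra.
  - destruct (Rle_dec t r).
    + assert (x 0 < x t) by (apply (PL_incr x 0 r); auto; lra). lra.
    + rewrite (Hid t) by lra. lra.
Qed.

Lemma PLF_incr_le x s t : PLF x -> s <= t -> x s <= x t.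
Proof. intros H [L| ->]; [apply Rlt_le; now apply PLF_incr|lra]. Qed.

Lemma PLF_inj x s t : PLF x -> x s = x t -> s = t.
Proof.
  intros H E. destruct (Rtotal_order s t) as [L|[?|L]]; auto; apply (PLF_incr x H) in L; lra.
Qed.

Lemma PLF_lt_inv x s t : PLF x -> x s < x t -> s < t.
Proof. intros H L. destruct (Rlt_dec s t); auto. pose proof (PLF_incr_le x t s H). lra. Qed.

Lemma PLF_zero x : PLF x -> x 0 = 0.
Proof. intros [H _]. apply H. lra. Qed.

Lemma PLF_r x : PLF x -> x r = r.
Proof. intros [H _]. apply H. lra. Qed.

Lemma PLF_range x t : PLF x -> 0 < t < r -> 0 < x t < r.
Proof.
  intros H [H1 H2]. apply (PLF_incr x H) in H1. apply (PLF_incr x H) in H2.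
  rewrite PLF_zero in H1 by auto. rewrite PLF_r in H2 by auto. lra.
Qed.

Lemma PLF_surj x s : PLF x -> exists t, x t = s.
Proof.
  intros H. destruct H as [Hid HP].
  destruct (Rle_dec s 0); [exists s; apply Hid; lra|].
  destruct (Rle_dec r s); [exists s; apply Hid; lra|].
  destruct (PL_surj x 0 r HP s) as (t & _ & E); [rewrite !Hid by lra; lra|eauto].
Qed.

Lemma PLF_id : PLF (fun t => t).
Proof.
  split; auto. apply PL_affine with 1; auto; try lra. intros. ring.
Qed.

Lemma PLF_comp x y : PLF x -> PLF y -> PLF (fun t => y (x t)).
Proof.
  intros Hx Hy. split.
  - intros t Ht. rewrite (proj1 Hx t Ht). now apply Hy.
  - apply PL_comp; [apply Hx|]. rewrite PLF_zero, PLF_r by auto. apply Hy.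
Qed.

Lemma PLF_inv x : PLF x -> exists y, PLF y /\ (forall t, y (x t) = t) /\ (forall t, x (y t) = t).
Proof.
  intros Hx. destruct (ClassicalEpsilon.choice (fun s t => x t = s)) as [y Hy].
  { intros s. now apply PLF_surj. }
  assert (Hy' : forall t, y (x t) = t) by (intros t; apply (PLF_inj x); auto).
  exists y. split; [|auto]. split.
  - intros t Ht. rewrite <- (proj1 Hx t Ht) at 1. apply Hy'.
  - rewrite <- (PLF_zero x Hx), <- (PLF_r x Hx) at 1. apply PL_inv; auto. apply Hx.
Qed.

Lemma PLF_reflect x : PLF x -> PLF (reflect x).
Proof.
  intros [H1 H2]. split.
  - intros t Ht. unfold reflect. rewrite H1 by lra. ring.
  - apply PL_reflect in H2. replace (r - r) with 0 in H2 by ring.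
    now replace (r - 0) with r in H2 by ring.
Qed.

Lemma reflect_reflect x : reflect (reflect x) = x.
Proof.
  apply functional_extensionality. intros t. unfold reflect.
  replace (r - (r - t)) with t by ring. ring.
Qed.

(** * Agreement with the group of the statement *)

Lemma PLF_inF x : PLF x -> inF r Lam A x.
Proof.
  intros Hx. pose proof Hx as [Hid HP].
  pose proof (PLF_zero x Hx) as E0. pose proof (PLF_r x Hx) as Er.
  assert (Hr : forall t, 0 <= t < r -> 0 <= x t < r).
  { intros t [[H| <-] Ht]; [pose proof (PLF_range x t Hx); lra|lra]. }
  split; [intros t Ht; apply Hid; lra|]. split; [auto|].
  split; [|split; [|split]].
  - intros s Hs. destruct (PLF_surj x s Hx) as [t Et]. exists t. split; auto.
    split.
    + destruct (Rle_dec 0 t); auto. rewrite (Hid t) in Et by lra. lra.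
    + destruct (Rlt_dec t r); auto. rewrite (Hid t) in Et by lra. lra.
  - intros t t' _ _ E. now apply (PLF_inj x).
  - destruct (PL_pieces x 0 r HP r_pos) as (n & c & lam & d & C0 & Cn & HC).
    exists n, c, lam, d. split; [auto|split; [auto|]].
    intros i Hi. destruct (HC i Hi) as (H1 & H2 & H3 & H4 & H5).
    repeat split; auto. intros t Ht. apply H5. lra.
  - intros t Ht. destruct (PL_lipschitz x 0 r HP) as (K & PK & HK).
    intros eps Heps. exists (eps / K). split; [now apply Rdiv_lt_0_compat|].
    intros s [Hs Hd]. simpl in *. unfold Rdist in *.
    assert (B : K * Rabs (s - t) < eps).
    { apply (Rmult_lt_compat_l K) in Hd; auto.
      replace (K * (eps / K)) with eps in Hd by (field; lra). auto. }
    destruct (Rle_dec s t) as [L|L].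
    + rewrite Rabs_left1 in B by lra.
      assert (x s <= x t) by now apply PLF_incr_le.
      assert (x t - x s <= K * (t - s)) by (apply HK; lra).
      rewrite Rabs_left1 by lra. lra.
    + rewrite Rabs_right in B by lra.
      assert (x t <= x s) by (apply PLF_incr_le; auto; lra).
      assert (x s - x t <= K * (s - t)) by (apply HK; lra).
      rewrite Rabs_right by lra. lra.
Qed.

Lemma left_limit_affine (x : R -> R) l b q p :
  0 < l -> 0 <= q < p -> p < r -> limit1_in x (fun y => 0 <= y < r) (x p) p ->
  (forall t, q <= t < p -> x t = l * t + b) -> x p = l * p + b.
Proof.
  intros Pl Hq Hp Hlim Hx. apply NNPP. intros Hne.
  set (eps := Rabs (x p - (l * p + b)) / 2).
  assert (Peps : 0 < eps).
  { unfold eps. assert (0 < Rabs (x p - (l * p + b))) by (apply Rabs_pos_lt; lra). lra. }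
  destruct (Hlim eps Peps) as (dl & Pdl & Hdl). simpl in Hdl. unfold Rdist in Hdl.
  (* At p - h the map is within [eps] of x p and the affine formula is within [eps] of its value at
     p, which is incompatible with a gap of 2 [eps] between these two. *)
  set (h := Rmin (p - q) (Rmin (dl / 2) (eps / l))).
  assert (0 < eps / l) by (apply Rdiv_lt_0_compat; auto).
  assert (Hh : 0 < h) by (unfold h; repeat apply Rmin_glb_lt; lra).
  assert (h <= p - q /\ h <= dl / 2 /\ h <= eps / l) as (h1 & h2 & h3).
  { unfold h. pose proof (Rmin_l (p - q) (Rmin (dl / 2) (eps / l))).
    pose proof (Rmin_r (p - q) (Rmin (dl / 2) (eps / l))).
    pose proof (Rmin_l (dl / 2) (eps / l)). pose proof (Rmin_r (dl / 2) (eps / l)). lra. }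
  assert (D : Rabs (x (p - h) - x p) < eps).
  { apply Hdl. split; [lra|]. rewrite Rabs_left by lra. lra. }
  rewrite (Hx (p - h)) in D by lra.
  assert (l * h <= eps).
  { apply (Rmult_le_compat_l l) in h3; [|lra].
    replace (l * (eps / l)) with eps in h3 by (field; lra). auto. }
  assert (Hl : 0 < l * h) by nra.
  apply Rabs_def2 in D.
  assert (2 * eps = Rabs (x p - (l * p + b))) by (unfold eps; field).
  revert H1. unfold Rabs. destruct Rcase_abs; lra.
Qed.

(** Continuity closes up the pieces at the interior breakpoints, and positive slopes make x
    increasing. At r, where no continuity is assumed, and at 0, the right values follow from x
    mapping [0, r) onto itself. *)
Lemma inF_PLF x : inF r Lam A x -> PLF x.
Proof.
  intros (Hid & Hran & Hsurj & Hinj & (n & a & lam & b & A0 & An & Hp) & Hlim).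
  assert (Mono : forall d i, (i + d <= n)%nat -> a i <= a (i + d)%nat /\ ((0 < d)%nat -> a i < a (i + d)%nat)).
  { induction d as [|d IH]; intros i Hi.
    - rewrite Nat.add_0_r. split; [lra|lia].
    - destruct (IH i) as [I1 _]; [lia|]. rewrite Nat.add_succ_r.
      destruct (Hp (i + d)%nat) as [I2 _]; [lia|]. split; intros; lra. }
  assert (Pos : forall i, (i <= n)%nat -> 0 <= a i).
  { intros i Hi. destruct (Mono i 0%nat) as [H _]; auto. simpl in H. lra. }
  assert (Ltr : forall i, (i < n)%nat -> a i < r).
  { intros i Hi. destruct (Mono (n - i)%nat i) as [_ H]; [lia|].
    replace (i + (n - i))%nat with n in H by lia. rewrite <- An. apply H. lia. }
  assert (HPL : forall i, (i < n)%nat -> PL x 0 (a i)).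
  { induction i as [|i IH]; intros Hi.
    - destruct (Hp 0%nat Hi) as (_ & _ & H3 & _). rewrite A0 in *.
      apply PL_affine with 1; auto; try lra. intros t Ht. replace t with 0 by lra. ring.
    - destruct (Hp i) as (H1 & H2 & H3 & H4 & H5); [lia|].
      destruct (Hp (S i)) as (_ & H2' & H3' & _); [lia|].
      pose proof (Pos i). pose proof (Ltr (S i) Hi).
      apply PL_cat with (a i); [apply IH; lia|].
      assert (E : x (a (S i)) = lam i * a (S i) + b i).
      { apply left_limit_affine with (a i); auto.
        - split; auto. apply Pos. lia.
        - apply Hlim. split; auto. apply Pos. lia. }
      apply PL_affine with (lam i); auto; try lra.
      intros t [Ht1 [Ht2| ->]]; rewrite (H5 (a i)) by lra; [rewrite H5 by lra; ring|rewrite E; ring]. }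
  assert (Er : x r = r) by (apply Hid; lra).
  assert (HP : PL x 0 r).
  { destruct n as [|m]; [rewrite A0 in An; lra|].
    destruct (Hp m) as (H1 & H2 & H3 & H4 & H5); [lia|]. rewrite An in *.
    set (c := a m) in *. set (l := lam m) in *. pose proof (Lam_pos l H4) as Pl.
    assert (HPc : PL x 0 c) by (apply HPL; lia).
    assert (0 <= c) by (apply Pos; lia).
    assert (Hc : x c = l * c + b m) by (apply H5; lra).
    (* If the left limit at r exceeded r, x would leave [0, r) just before r; if it were smaller,
       the increasing map x would never attain it. *)
    assert (L : l * r + b m = r).
    { apply Rle_antisym; apply Rnot_lt_le; intros C.
      - set (t := Rmax c (r - (l * r + b m - r) / l)).
        assert (E : l * ((l * r + b m - r) / l) = l * r + b m - r) by (field; lra).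
        assert (0 < (l * r + b m - r) / l) by (apply Rdiv_lt_0_compat; lra).
        assert (c <= t < r).
        { unfold t. split; [apply Rmax_l|]. apply Rmax_lub_lt; lra. }
        assert (r - (l * r + b m - r) / l <= t) by apply Rmax_r.
        assert (x t < r) by (apply Hran; lra). rewrite H5 in * by lra. nra.
      - assert (0 <= x c) by (apply Hran; lra).
        assert (x c < l * r + b m) by nra.
        destruct (Hsurj (l * r + b m)) as (t & Ht & E); [lra|].
        destruct (Rle_dec c t).
        + rewrite H5 in E by lra. nra.
        + assert (x t < x c) by (apply (PL_incr x 0 c); auto; lra). lra. }
    apply PL_cat with c; auto. apply PL_affine with l; auto; try lra.
    intros t [Ht1 [Ht2| ->]]; rewrite Hc; [rewrite H5 by lra; ring|rewrite Er; lra]. }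
  split; auto. intros t [[Ht| ->]|Ht]; try (apply Hid; lra).
  destruct (Hsurj 0) as (t & Ht & E); [lra|].
  assert (x 0 <= x t) by (apply (PL_incr_le x 0 r); auto; lra).
  assert (0 <= x 0) by (apply Hran; lra). lra.
Qed.

Lemma inF_eq : inF r Lam A = PLF.
Proof.
  apply functional_extensionality. intros x. apply propositional_extensionality.
  split; [apply inF_PLF|apply PLF_inF].
Qed.

(** * Germs at the ends *)

Definition slope_at_zero (x : R -> R) (z : Z) : Prop :=
  exists eps, 0 < eps /\ forall t, 0 <= t <= eps -> x t = powerRZ g z * t.

Lemma slope_ex x : PLF x -> exists z, slope_at_zero x z.
Proof.
  intros Hx. destruct (PL_germ x 0 r 0) as (l & eps & Hl & He & H); [apply Hx|lra|].
  apply Lam_iff in Hl as [z ->]. exists z, eps. split; auto. intros t Ht.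
  rewrite H, PLF_zero by (auto; lra). ring.
Qed.

Lemma slope_unique x m n : slope_at_zero x m -> slope_at_zero x n -> m = n.
Proof.
  intros (e1 & P1 & H1) (e2 & P2 & H2). apply powerRZ_inj.
  set (t := Rmin e1 e2). assert (0 < t) by (apply Rmin_glb_lt; auto).
  assert (t <= e1) by apply Rmin_l. assert (t <= e2) by apply Rmin_r.
  apply Rmult_eq_reg_r with t; [|lra]. rewrite <- H1, <- H2 by lra. reflexivity.
Qed.

Lemma slope_comp x y m n : slope_at_zero x m -> slope_at_zero y n ->
  slope_at_zero (fun t => y (x t)) (m + n).
Proof.
  intros (e1 & P1 & H1) (e2 & P2 & H2). pose proof (powerRZ_pos m) as Pm.
  assert (0 < e2 / powerRZ g m) by (apply Rdiv_lt_0_compat; auto).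
  exists (Rmin e1 (e2 / powerRZ g m)). split; [now apply Rmin_glb_lt|].
  intros t [Ht1 Ht2].
  pose proof (Rle_trans _ _ _ Ht2 (Rmin_l _ _)) as B1.
  pose proof (Rle_trans _ _ _ Ht2 (Rmin_r _ _)) as B2.
  apply (Rmult_le_compat_l (powerRZ g m)) in B2; [|lra].
  replace (powerRZ g m * (e2 / powerRZ g m)) with e2 in B2 by (field; lra).
  rewrite H1, H2, powerRZ_plus by (auto; split; auto; nra). ring.
Qed.

(** [true] stands for the end 0 and [false] for the end r. The choice is harmless, since the
    exponent exists by [slope_ex] and is unique by [slope_unique]. *)
Definition val (e : bool) (x : R -> R) : Z :=
  epsilon (inhabits 0%Z) (slope_at_zero (if e then x else reflect x)).

Lemma val_spec (e : bool) x : PLF x -> slope_at_zero (if e then x else reflect x) (val e x).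
Proof.
  intros Hx. unfold val. apply epsilon_spec, slope_ex. destruct e; auto using PLF_reflect.
Qed.

Lemma val_true x z : PLF x -> slope_at_zero x z -> val true x = z.
Proof. intros Hx. apply slope_unique. exact (val_spec true x Hx). Qed.

Lemma val_reflect e x : val e (reflect x) = val (negb e) x.
Proof. destruct e; unfold val; simpl; now rewrite ?reflect_reflect. Qed.

Lemma reflect_comp x y : reflect (Fop tt x y) = Fop tt (reflect x) (reflect y).
Proof.
  apply functional_extensionality. intros t. unfold reflect, Fop.
  now replace (r - (r - x (r - t))) with (x (r - t)) by ring.
Qed.

Lemma reflect_id : reflect (fun t => t) = fun t => t.
Proof. apply functional_extensionality. intros t. unfold reflect. ring. Qed.

Lemma reflect_inj x y : reflect x = reflect y -> x = y.
Proof. intros H. rewrite <- (reflect_reflect x), H. apply reflect_reflect. Qed.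

Lemma val_comp e x y : PLF x -> PLF y -> val e (Fop tt x y) = (val e x + val e y)%Z.
Proof.
  assert (K : forall x y, PLF x -> PLF y -> val true (Fop tt x y) = (val true x + val true y)%Z).
  { intros x' y' Hx Hy. apply val_true; [exact (PLF_comp _ _ Hx Hy)|].
    exact (slope_comp x' y' _ _ (val_spec true x' Hx) (val_spec true y' Hy)). }
  intros Hx Hy. destruct e; auto.
  pose proof (val_reflect true (Fop tt x y)) as E. simpl in E.
  rewrite <- E, reflect_comp, K, !val_reflect by now apply PLF_reflect. reflexivity.
Qed.

Lemma val_zero x : PLF x ->
  (val true x = 0%Z <-> exists eps, 0 < eps /\ forall t, t <= eps -> x t = t).
Proof.
  intros Hx. split.
  - intros E. destruct (val_spec true x Hx) as (eps & Pe & H). rewrite E in H.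
    exists eps. split; auto. intros t Ht. destruct (Rle_dec 0 t).
    + rewrite H by lra. simpl. ring.
    + apply Hx. lra.
  - intros (eps & Pe & H). apply val_true; auto. exists eps. split; auto.
    intros t Ht. rewrite H by lra. simpl. ring.
Qed.

Lemma val_zero_right x : PLF x ->
  (val false x = 0%Z <-> exists s, s < r /\ forall t, s <= t -> x t = t).
Proof.
  intros Hx. pose proof (val_reflect true x) as E. simpl in E. rewrite <- E.
  rewrite val_zero by now apply PLF_reflect. unfold reflect. split.
  - intros (eps & Pe & H). exists (r - eps). split; [lra|]. intros t Ht.
    specialize (H (r - t)). replace (r - (r - t)) with t in H by ring.
    assert (r - x t = r - t) by (apply H; lra). lra.
  - intros (s & Ps & H). exists (r - s). split; [lra|]. intros t Ht. rewrite H by lra. ring.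
Qed.

Lemma val_inverse e x y : PLF x -> PLF y -> (forall t, y (x t) = t) -> val e y = (- val e x)%Z.
Proof.
  intros Hx Hy H. pose proof (val_comp e x y Hx Hy) as E.
  assert (E' : Fop tt x y = fun t => t) by (apply functional_extensionality; exact H).
  assert (val e (fun t => t) = 0%Z); [|rewrite E', H0 in E; lia].
  pose proof (val_comp e _ _ PLF_id PLF_id) as E2. unfold Fop in E2. lia.
Qed.

(** * Dynamics of commuting elements *)

Notation commutes := (commute Fop).

Lemma commutes_iff x y : commutes x y <-> forall t, y (x t) = x (y t).
Proof.
  split; intros H.
  - intros t. exact (f_equal (fun f => f t) H).
  - now apply functional_extensionality.
Qed.

Lemma commutes_reflect x y : commutes x y -> commutes (reflect x) (reflect y).
Proof. unfold commute. rewrite <- !reflect_comp. congruence. Qed.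

Lemma commutes_inverse h k h' :
  (forall t, h' (h t) = t) -> (forall t, h (h' t) = t) -> commutes h k -> commutes h' k.
Proof.
  rewrite !commutes_iff. intros H1 H2 H t.
  rewrite <- (H1 (k (h' t))), <- H, H2. reflexivity.
Qed.

Lemma commutes_disjoint f h c : PLF f -> PLF h ->
  (forall t, c <= t -> f t = t) -> (forall t, t <= c -> h t = t) -> commutes f h.
Proof.
  intros Pf Ph Hf Hh. apply commutes_iff. intros t. destruct (Rle_dec t c) as [L|L].
  - assert (f t <= f c) by now apply PLF_incr_le. rewrite (Hf c) in * by lra.
    now rewrite !Hh.
  - assert (h c <= h t) by (apply PLF_incr_le; auto; lra). rewrite (Hh c) in * by lra.
    rewrite !Hf by lra. reflexivity.
Qed.

(** The orbit of t decreases to a limit, which h fixes and which can only be p. The iterate [h'] is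
    described by what it commutes with, so that no exponent appears. *)
Lemma descend h p t : PLF h -> h p = p -> p < t -> h t < t ->
  (forall s, p < s <= t -> h s <> s) -> forall eps, 0 < eps ->
  exists h', PLF h' /\ (forall k, commutes h k -> commutes h' k) /\ p < h' t < p + eps.
Proof.
  intros Ph Hp Hpt Ht Hfix eps Peps.
  set (f := fun n s => Nat.iter n h s).
  assert (Pf : forall n, PLF (f n)).
  { induction n; [exact PLF_id|]. exact (PLF_comp _ _ IHn Ph). }
  assert (Cf : forall k, commutes h k -> forall n, commutes (f n) k).
  { intros k Hk. rewrite commutes_iff in Hk. induction n; apply commutes_iff; intros s; [reflexivity|].
    rewrite commutes_iff in IHn. simpl. rewrite Hk. f_equal. apply IHn. }
  assert (Fp : forall n, f n p = p) by (induction n; simpl; congruence).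
  assert (Low : forall n, p < f n t) by (intros n; rewrite <- (Fp n) at 1; now apply PLF_incr).
  assert (Dec : forall n, f (S n) t < f n t).
  { induction n; simpl; auto. now apply (PLF_incr h). }
  assert (Top : forall n, f n t <= t) by (induction n; [simpl; lra|specialize (Dec n); lra]).
  destruct (completeness (fun s => exists n, s = - f n t)) as [m [Ub Lub]].
  { exists (- p). intros s [n ->]. specialize (Low n). lra. }
  { exists (- f 0%nat t), 0%nat. reflexivity. }
  set (L := - m).
  assert (LL : forall n, L <= f n t).
  { intros n. assert (- f n t <= m) by (apply Ub; eauto). unfold L. lra. }
  assert (LG : forall b, (forall n, b <= f n t) -> b <= L).
  { intros b Hb. assert (m <= - b); [|unfold L; lra]. apply Lub. intros s [n ->].
    specialize (Hb n). lra. }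
  assert (HL : h L = L).
  { apply Rle_antisym.
    - apply LG. intros n. specialize (Dec n). simpl in Dec.
      assert (h L <= h (f n t)) by (apply PLF_incr_le; auto). unfold f in *. simpl in *. lra.
    - destruct (PLF_inv h Ph) as (h1 & P1 & I1 & I2).
      assert (K : h1 L <= L).
      { apply LG. intros n. rewrite <- (I1 (f n t)). apply PLF_incr_le; auto. apply (LL (S n)). }
      apply (PLF_incr_le h) in K; auto. now rewrite I2 in K. }
  assert (p <= L) by (apply LG; intros n; specialize (Low n); lra).
  assert (L = p).
  { destruct (Req_dec L p) as [|Hne]; auto. exfalso. apply (Hfix L); auto.
    specialize (LL 0%nat). simpl in LL. lra. }
  assert (exists n, f n t < p + eps) as [n Hn].
  { apply NNPP. intros Hno. assert (p + eps <= L); [|lra]. apply LG. intros n.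
    apply Rnot_lt_le. eauto. }
  exists (f n). split; [auto|split; [|split; auto]]. intros k Hk. now apply Cf.
Qed.

Lemma approach h p q t : PLF h -> h p = p -> p < t < q -> (forall s, p < s < q -> h s <> s) ->
  forall eps, 0 < eps ->
  exists h', PLF h' /\ (forall k, commutes h k -> commutes h' k) /\ p < h' t < p + eps.
Proof.
  intros Ph Hp Ht Hfix eps Peps.
  destruct (Rtotal_order (h t) t) as [L|[E|L]].
  - apply (descend h p t); auto; try lra. intros s Hs. apply Hfix. lra.
  - exfalso. now apply (Hfix t).
  - destruct (PLF_inv h Ph) as (h1 & P1 & I1 & I2).
    destruct (descend h1 p t) with eps as (h' & P' & C' & R'); auto; try lra.
    + rewrite <- Hp at 1. apply I1.
    + apply (PLF_lt_inv h); auto. now rewrite I2.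
    + intros s Hs E. apply (Hfix s); [lra|]. rewrite <- E at 1. apply I2.
    + exists h'. split; [auto|split; [|auto]]. intros k Hk. apply C'.
      now apply (commutes_inverse h).
Qed.

(* The orbit of a fixed point of k under h accumulates at p, where k is affine; hence k is
   the identity near p, and on (p, q) by conjugation with h. *)
Lemma commuting_fixed_point h k p q t0 : PLF h -> PLF k -> commutes h k ->
  0 <= p -> q <= r -> h p = p -> (forall s, p < s < q -> h s <> s) ->
  p < t0 < q -> k t0 = t0 -> forall t, p < t < q -> k t = t.
Proof.
  intros Ph Pk C Hp Hq Hhp Hfix Ht0 Hk0.
  assert (F : forall eps, 0 < eps -> exists s, p < s < p + eps /\ k s = s).
  { intros eps Pe. destruct (approach h p q t0) with eps as (h' & P' & C' & R'); auto.
    exists (h' t0). split; auto. apply C', commutes_iff with (t := t0) in C.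
    now rewrite C, Hk0. }
  destruct (PL_germ k 0 r p) as (l & eps & Hl & Pe & Hg); [apply Pk|lra|].
  destruct (F eps Pe) as (s1 & R1 & E1). destruct (F (s1 - p)) as (s2 & R2 & E2); [lra|].
  assert (G1 : k s1 = k p + l * (s1 - p)) by (apply Hg; lra).
  assert (G2 : k s2 = k p + l * (s2 - p)) by (apply Hg; lra).
  (* Two distinct fixed points on an affine stretch force slope 1, and then k is the identity on
     [p, p + eps]. *)
  assert (l = 1).
  { assert (E : (l - 1) * (s1 - s2) = 0) by (rewrite E1 in G1; rewrite E2 in G2; lra).
    apply Rmult_integral in E. lra. }
  subst l.
  intros t Ht. destruct (approach h p q t) with eps as (h' & P' & C' & R'); auto.
  apply C', commutes_iff with (t := t) in C. apply (PLF_inj h'); auto. rewrite <- C.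
  rewrite Hg by lra. lra.
Qed.

Lemma PLF_eq_id k : PLF k -> (forall t, 0 < t < r -> k t = t) -> k = fun t => t.
Proof.
  intros Pk H. apply functional_extensionality. intros t.
  destruct (Rle_dec t 0); [apply Pk; lra|]. destruct (Rle_dec r t); [apply Pk; lra|]. apply H. lra.
Qed.

Lemma commuting_fixed_point_id h k t0 : PLF h -> PLF k -> commutes h k ->
  (forall s, 0 < s < r -> h s <> s) -> 0 < t0 < r -> k t0 = t0 -> k = fun t => t.
Proof.
  intros Ph Pk C Hfix Ht0 Hk. apply PLF_eq_id; auto.
  apply commuting_fixed_point with (h := h) (t0 := t0); auto using PLF_zero; lra.
Qed.

Lemma thin_fixed_point y : PLF y -> thin val y -> exists t, 0 < t < r /\ y t = t.
Proof.
  intros Hy [E|E].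
  - apply val_zero in E as (eps & Pe & H); auto.
    exists (Rmin eps (r / 2)). pose proof (Rmin_l eps (r / 2)). pose proof (Rmin_r eps (r / 2)).
    assert (0 < Rmin eps (r / 2)) by (apply Rmin_glb_lt; lra).
    split; [lra|]. apply H. lra.
  - apply val_zero_right in E as (s & Ps & H); auto.
    exists (Rmax s (r / 2)). pose proof (Rmax_l s (r / 2)). pose proof (Rmax_r s (r / 2)).
    assert (Rmax s (r / 2) < r) by (apply Rmax_lub_lt; lra).
    split; [lra|]. apply H. lra.
Qed.

Lemma fixed_point_free_rigid x : PLF x -> (forall s, 0 < s < r -> x s <> s) ->
  rigid PLF Fop (fun t => t) val x.
Proof.
  intros Px Hfix y Py C T. destruct (thin_fixed_point y Py T) as (t & Ht & E).
  now apply (commuting_fixed_point_id x y t).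
Qed.

(** Since the slope at 0 is not 1, the fixed points in (0, r) stay away from 0 and have a positive
    infimum. Both h and its inverse map this infimum to at most itself, so h fixes it. *)
Lemma first_fixed_point h : PLF h -> val true h <> 0%Z -> (exists t, 0 < t < r /\ h t = t) ->
  exists a, 0 < a < r /\ h a = a /\ forall t, 0 < t < a -> h t <> t.
Proof.
  intros Ph V (t0 & Ht0 & E0).
  destruct (val_spec true h Ph) as (eps & Pe & He). set (z := val true h) in *.
  assert (Hz : powerRZ g z <> 1).
  { intros E. apply V. apply powerRZ_inj. now rewrite E. }
  assert (Far : forall t, 0 < t -> h t = t -> eps < t).
  { intros t Pt Et. apply Rnot_le_lt. intros L. rewrite He in Et by lra. apply Hz.
    apply Rmult_eq_reg_r with t; lra. }
  destruct (completeness (fun s => exists t, 0 < t /\ h t = t /\ s = - t)) as [m [Ub Lub]].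
  { exists 0. intros s (t & Pt & _ & ->). lra. }
  { exists (- t0), t0. split; [lra|auto]. }
  assert (LL : forall t, 0 < t -> h t = t -> - m <= t).
  { intros t Pt Et. assert (- t <= m) by (apply Ub; eauto). lra. }
  assert (LG : forall b, (forall t, 0 < t -> h t = t -> b <= t) -> b <= - m).
  { intros b Hb. assert (m <= - b); [|lra]. apply Lub. intros s (t & Pt & Et & ->).
    specialize (Hb t Pt Et). lra. }
  assert (eps <= - m) by (apply LG; intros t Pt Et; apply Rlt_le; auto).
  assert (- m <= t0) by (apply LL; auto; lra).
  exists (- m). split; [lra|split].
  - apply Rle_antisym.
    + apply LG. intros t Pt Et. rewrite <- Et. apply PLF_incr_le; auto.
    + destruct (PLF_inv h Ph) as (h1 & P1 & I1 & I2).
      assert (K : h1 (- m) <= - m).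
      { apply LG. intros t Pt Et. rewrite <- (I1 t), Et. apply PLF_incr_le; auto. }
      apply (PLF_incr_le h) in K; auto. now rewrite I2 in K.
  - intros t Ht Et. specialize (LL t). lra.
Qed.

(** An element commuting with h permutes the fixed points of h and preserves their order, hence
    fixes the first one. *)
Lemma first_fixed_point_commutes h k a : PLF h -> PLF k -> commutes h k -> 0 < a < r ->
  h a = a -> (forall t, 0 < t < a -> h t <> t) -> k a = a.
Proof.
  intros Ph Pk C Ha Ea Hfix.
  assert (K : forall k, PLF k -> commutes h k -> a <= k a).
  { intros k' Pk' C'. apply Rnot_lt_le. intros L. apply (Hfix (k' a)).
    - split; auto. now apply (PLF_range k').
    - apply commutes_iff with (t := a) in C'. now rewrite <- C', Ea. }
  apply Rle_antisym; [|now apply K].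
  destruct (PLF_inv k Pk) as (k1 & P1 & I1 & I2).
  assert (H : a <= k1 a).
  { apply K; auto. apply commute_sym, (commutes_inverse k); auto. now apply commute_sym. }
  apply (PLF_incr_le k) in H; auto. now rewrite I2 in H.
Qed.

(** * Bumps *)

Lemma A_IZR z a : A a -> A (IZR z * a).
Proof.
  intros Ha.
  assert (N : forall n, A (INR n * a)).
  { induction n; [simpl; now rewrite Rmult_0_l|]. rewrite S_INR, Rmult_plus_distr_r, Rmult_1_l. auto. }
  destruct (Z.le_ge_cases 0 z) as [H|H].
  - rewrite <- (Z2Nat.id z), <- INR_IZR_INZ by auto. auto.
  - replace (IZR z * a) with (- (INR (Z.to_nat (- z)) * a)); auto.
    rewrite INR_IZR_INZ, Z2Nat.id, opp_IZR by lia. ring.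
Qed.

(** A contains the positive numbers g^N r, which become arbitrarily small, together with their
    integer multiples. *)
Lemma A_dense lo hi : lo < hi -> exists t, A t /\ lo < t < hi.
Proof.
  intros H. destruct (pow_lt_1_zero g) with ((hi - lo) / r) as [N HN].
  { rewrite Rabs_right; lra. }
  { apply Rdiv_lt_0_compat; lra. }
  specialize (HN N (le_n N)). pose proof (pow_lt g N g_pos) as P.
  rewrite Rabs_right in HN by lra.
  assert (S : g ^ N * r < hi - lo).
  { apply (Rmult_lt_compat_r r) in HN; auto. unfold Rdiv in HN.
    rewrite Rmult_assoc, Rinv_l in HN by lra. lra. }
  set (e := g ^ N * r) in *. assert (0 < e) by (unfold e; nra).
  assert (A e) by (apply A_scale; auto; rewrite pow_powerRZ; apply Lam_powerRZ).
  exists (IZR (up (lo / e)) * e). split; [now apply A_IZR|].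
  destruct (archimed (lo / e)) as [U1 U2].
  assert (E : lo / e * e = lo) by (field; lra).
  split; nra.
Qed.

(** The line of slope l through the origin and the line of slope m through (d, d) form a corner
    below the diagonal when l < 1 < m. The maximum draws this corner, and the minimum with t
    restores the identity outside [0, d]. *)
Definition bump (l m d t : R) : R := Rmin t (Rmax (l * t) (d - m * (d - t))).

Lemma bump_values l m s d t : l < 1 -> 1 < m -> 0 <= s -> (m - l) * s = (m - 1) * d ->
  (t <= 0 \/ d <= t -> bump l m d t = t) /\
  (0 <= t <= s -> bump l m d t = l * t) /\
  (s <= t <= d -> bump l m d t = d - m * (d - t)).
Proof.
  intros Hl Hm Hs E. assert (Hd : s <= d) by nra. unfold bump.
  assert (Cmp : d - m * (d - t) - l * t = (m - l) * (t - s)) by lra.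
  pose proof (Rmax_l (l * t) (d - m * (d - t))). pose proof (Rmax_r (l * t) (d - m * (d - t))).
  split; [|split].
  - intros [Ht|Ht]; apply Rmin_left; nra.
  - intros Ht. rewrite Rmax_left by nra. apply Rmin_right. nra.
  - intros Ht. rewrite Rmax_right by nra. apply Rmin_right. nra.
Qed.

(** Parametrizing by c, with support up to (m - l) c and corner at (m - 1) c, puts both breakpoints
    in A without a division by m - l. *)
Lemma bump_PLF l m c : Lam l -> Lam m -> l < 1 -> 1 < m -> A c -> 0 < c -> (m - l) * c <= r ->
  PLF (bump l m ((m - l) * c)).
Proof.
  intros Ll Lm Hl Hm Ac Pc Hr. set (d := (m - l) * c) in *. set (s := (m - 1) * c).
  assert (Ps : 0 < s) by (unfold s; nra). pose proof (Lam_pos l Ll) as Pl.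
  assert (Hsd : s < d) by (unfold s, d; nra).
  assert (E : (m - l) * s = (m - 1) * d) by (unfold s, d; ring).
  assert (V := fun t => bump_values l m s d t Hl Hm (Rlt_le _ _ Ps) E).
  assert (Vo : forall t, t <= 0 \/ d <= t -> bump l m d t = t) by (intros t; apply V).
  assert (V1 : forall t, 0 <= t <= s -> bump l m d t = l * t) by (intros t; apply V).
  assert (V2 : forall t, s <= t <= d -> bump l m d t = d - m * (d - t)) by (intros t; apply V).
  assert (As : A s) by (unfold s; replace ((m - 1) * c) with (m * c - c) by ring; auto).
  assert (Ad : A d) by (unfold d; replace ((m - l) * c) with (m * c - l * c) by ring; auto).
  split; [intros t Ht; apply Vo; lra|].
  apply PL_cat with d; [apply PL_cat with s|].
  - apply PL_affine with l; auto; try lra; rewrite ?(Vo 0) by lra; auto.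
    intros t Ht. rewrite V1 by auto. ring.
  - apply PL_affine with m; auto; try lra; rewrite (V1 s) by lra; auto.
    intros t Ht. rewrite V2 by auto. lra.
  - apply PL_affine with 1; auto; try lra; rewrite (Vo d) by lra; auto.
    intros t Ht. rewrite Vo by lra. ring.
Qed.

Lemma left_bump_ex m lo hi : (0 < m)%Z -> 0 <= lo -> lo < hi -> hi <= r ->
  exists d f, lo < d < hi /\ PLF f /\ (forall t, d <= t -> f t = t) /\
    (forall t, 0 < t < d -> f t < t) /\ val true f = m.
Proof.
  intros Hm Hlo Hlh Hhi. pose proof (powerRZ_lt1 m Hm) as H1. pose proof (powerRZ_pos m) as Pm.
  set (l := powerRZ g m) in *. set (u := / g).
  assert (Lu : Lam u) by (apply Lam_inv, Lam_iff; exists 1%Z; simpl; ring).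
  assert (Hu : 1 < u) by (unfold u; rewrite <- Rinv_1; apply Rinv_lt_contravar; lra).
  assert (P : 0 < u - l) by lra.
  destruct (A_dense (lo / (u - l)) (hi / (u - l))) as (c & Ac & Hc1 & Hc2).
  { apply Rmult_lt_compat_r; auto. now apply Rinv_0_lt_compat. }
  assert (E1 : (u - l) * (lo / (u - l)) = lo) by (field; lra).
  assert (E2 : (u - l) * (hi / (u - l)) = hi) by (field; lra).
  assert (B1 : lo < (u - l) * c) by nra. assert (B2 : (u - l) * c < hi) by nra.
  assert (Pc : 0 < c) by nra.
  exists ((u - l) * c), (bump l u ((u - l) * c)).
  assert (PF : PLF (bump l u ((u - l) * c))) by (apply bump_PLF; auto; [apply Lam_powerRZ|lra]).
  set (d := (u - l) * c) in *. set (s := (u - 1) * c).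
  assert (Ps : 0 < s) by (unfold s; nra).
  assert (E : (u - l) * s = (u - 1) * d) by (unfold s, d; ring).
  assert (V := fun t => bump_values l u s d t H1 Hu (Rlt_le _ _ Ps) E).
  split; [auto|split; [auto|split; [|split]]].
  - intros t Ht. apply V. auto.
  - intros t Ht. destruct (Rle_dec t s).
    + rewrite (proj1 (proj2 (V t))) by lra. nra.
    + rewrite (proj2 (proj2 (V t))) by lra. nra.
  - apply val_true; auto. exists s. split; auto. intros t Ht. now apply V.
Qed.

(** The reflection of a left bump moves points to the right, so its inverse moves them to the left,
    and inversion turns the value 1 into -1. *)
Lemma right_bump_ex lo hi : 0 <= lo -> lo < hi -> hi <= r ->
  exists c f, lo < c < hi /\ PLF f /\ (forall t, t <= c -> f t = t) /\
    (forall t, c < t < r -> f t < t) /\ val true f = 0%Z /\ val false f = (-1)%Z.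
Proof.
  intros Hlo Hlh Hhi.
  destruct (left_bump_ex 1 (r - hi) (r - lo)) as (d & f & Hd & Pf & F1 & F2 & V); try lra; [lia|].
  pose proof (PLF_reflect f Pf) as Pq.
  destruct (PLF_inv (reflect f) Pq) as (h & Ph & I1 & I2).
  assert (Hid : forall t, t <= r - d -> h t = t).
  { intros t Ht. rewrite <- (I1 t) at 2. f_equal. unfold reflect. rewrite F1 by lra. ring. }
  exists (r - d), h. split; [lra|split; [auto|split; [auto|split; [|split]]]].
  - intros t Ht. apply (PLF_lt_inv (reflect f)); auto. rewrite I2. unfold reflect.
    assert (f (r - t) < r - t) by (apply F2; lra). lra.
  - apply val_zero; auto. exists (r - d). split; [lra|auto].
  - rewrite (val_inverse false (reflect f) h), val_reflect by auto. simpl. now rewrite V.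
Qed.

(** The supports (0, d) and (c, r) overlap around r / 2, so each interior point is moved to the left
    by one factor at least and to the right by none. Each factor alone determines the slope at its
    end. *)
Lemma left_mover_ex m : (0 < m)%Z -> exists x, PLF x /\ (forall t, 0 < t < r -> x t < t) /\
  val true x = m /\ val false x = (-1)%Z.
Proof.
  intros Hm.
  destruct (left_bump_ex m (r / 2) r) as (d & f & Hd & Pf & F1 & F2 & V); auto; try lra.
  destruct (right_bump_ex 0 (r / 2)) as (c & h & Hc & Ph & H1 & H2 & W1 & W2); try lra.
  exists (Fop tt f h). split; [exact (PLF_comp f h Pf Ph)|]. rewrite !val_comp, V, W1, W2 by auto.
  split; [|split; [lia|]].
  - intros t Ht. unfold Fop. destruct (Rlt_dec t d).
    + assert (f t < t) by (apply F2; lra).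
      assert (h (f t) <= f t); [|lra].
      destruct (Rle_dec (f t) c); [rewrite H1; lra|]. apply Rlt_le, H2. lra.
    + rewrite F1 by lra. apply H2. lra.
  - assert (val false f = 0%Z); [|lia]. apply val_zero_right; auto. exists d. split; [lra|auto].
Qed.

(** * The two-ended structure *)

Notation id := (fun t : R => t).

Lemma not_id x t : x t <> t -> x <> id.
Proof. intros H E. now rewrite E in H. Qed.

Definition commuting_conjugate (h u k : R -> R) : Prop :=
  exists h', PLF h' /\ Fop tt u h' = Fop tt h u /\ commutes h' k.

Lemma conjugate_ex h u : PLF h -> PLF u ->
  exists h', PLF h' /\ Fop tt u h' = Fop tt h u /\ forall s, h s = s -> h' (u s) = u s.
Proof.
  intros Ph Pu. destruct (PLF_inv u Pu) as (w & Pw & I1 & I2).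
  exists (fun t => u (h (w t))). split; [|split].
  - exact (PLF_comp _ _ (PLF_comp _ _ Pw Ph) Pu).
  - apply functional_extensionality. intros t. unfold Fop. now rewrite I1.
  - intros s Hs. now rewrite I1, Hs.
Qed.

Lemma conjugate_reflect h u k :
  commuting_conjugate (reflect h) (reflect u) k -> commuting_conjugate h u (reflect k).
Proof.
  intros (h' & Ph & E & C). exists (reflect h').
  split; [now apply PLF_reflect|split].
  - apply reflect_inj. now rewrite !reflect_comp, reflect_reflect.
  - now apply commutes_reflect.
Qed.

(** h is trivial up to c and its conjugate up to u c; a bump supported to the left of both points
    commutes with both elements. *)
Lemma thin_left h u : PLF h -> val true h = 0%Z -> PLF u ->
  exists k, PLF k /\ k <> id /\ commutes h k /\ commuting_conjugate h u k.
Proof.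
  intros Ph V Pu. apply val_zero in V as (eps & Pe & He); auto.
  set (c := Rmin eps (r / 2)). assert (Pc : 0 < c) by (apply Rmin_glb_lt; lra).
  assert (c <= eps) by apply Rmin_l. assert (c <= r / 2) by apply Rmin_r.
  assert (Pu' : 0 < u c < r) by (apply PLF_range; auto; lra).
  set (e := Rmin c (u c)). assert (0 < e) by (apply Rmin_glb_lt; lra).
  assert (e <= c) by apply Rmin_l. assert (e <= u c) by apply Rmin_r.
  destruct (left_bump_ex 1 0 e) as (d & k & Hd & Pk & K1 & K2 & _); try lra; [lia|].
  exists k. split; [auto|split; [|split]].
  - apply not_id with (d / 2). assert (k (d / 2) < d / 2) by (apply K2; lra). lra.
  - apply commute_sym, (commutes_disjoint k h d); auto. intros t Ht. apply He. lra.
  - destruct (conjugate_ex h u Ph Pu) as (h' & P' & E' & F'). exists h'. split; [auto|split; auto].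
    apply commute_sym, (commutes_disjoint k h' d); auto. intros t Ht.
    destruct (PLF_surj u t Pu) as [s <-]. apply F', He.
    assert (s <= c); [|lra]. apply Rnot_lt_le. intros L. apply (PLF_incr u) in L; auto. lra.
Qed.

Lemma thin_centralizers h u : PLF h -> thin val h -> PLF u ->
  exists k, PLF k /\ k <> id /\ commutes h k /\ commuting_conjugate h u k.
Proof.
  intros Ph [V|V] Pu; [now apply thin_left|].
  destruct (thin_left (reflect h) (reflect u)) as (k & Pk & Nk & Ck & Hk);
    [now apply PLF_reflect|now rewrite val_reflect|now apply PLF_reflect|].
  exists (reflect k). split; [now apply PLF_reflect|split; [|split]].
  - intros E. apply Nk, reflect_inj. now rewrite E, reflect_id.
  - apply commutes_reflect in Ck. now rewrite reflect_reflect in Ck.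
  - now apply conjugate_reflect.
Qed.

(* A conjugator that pushes all the interior fixed points of h into its first bump. *)
Lemma separating_conjugator h t0 : PLF h -> ~ thin val h -> 0 < t0 < r -> h t0 = t0 ->
  exists u, PLF u /\ forall k, PLF k -> commutes h k -> commuting_conjugate h u k -> k = id.
Proof.
  intros Ph NT Ht0 E0. unfold thin in NT.
  destruct (first_fixed_point h) as (a & Ha & Ea & Fa); eauto.
  destruct (first_fixed_point (reflect h)) as (b' & Hb' & Eb' & Fb').
  { now apply PLF_reflect. }
  { rewrite val_reflect. tauto. }
  { exists (r - t0). split; [lra|]. unfold reflect. replace (r - (r - t0)) with t0 by ring. lra. }
  set (b := r - b') in *. assert (Eb : h b = b) by (unfold reflect, b in *; lra).
  assert (Fb : forall t, b < t < r -> h t <> t).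
  { intros t Ht E. apply (Fb' (r - t)); [unfold b in *; lra|]. unfold reflect.
    replace (r - (r - t)) with t by ring. lra. }
  assert (Hab : a <= b).
  { apply Rnot_lt_le. intros L. apply (Fa b); auto. unfold b in *. lra. }
  destruct (left_mover_ex 1) as (x & Px & Mx & _ & _); [lia|].
  (* [u] carries the last fixed point b of h below the first one, a. The interior fixed points of
     the conjugate h' then lie between u a and u b, inside the first bump (0, a) of h. *)
  destruct (descend x 0 b Px) with a as (u & Pu & _ & Hu); try (unfold b in *; lra).
  { now apply PLF_zero. }
  { apply Mx. unfold b in *. lra. }
  { intros s Hs. specialize (Mx s). unfold b in *. lra. }
  exists u. split; [auto|]. intros k Pk Ck (h' & Ph' & Eh' & Ck').
  assert (Eh : forall t, h' (u t) = u (h t)) by (intros t; exact (f_equal (fun f => f t) Eh')).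
  assert (Hua : 0 < u a < r) by (apply PLF_range; auto).
  assert (u a <= u b) by (apply PLF_incr_le; auto).
  assert (Fh' : forall t, h' (u t) = u t -> h t = t) by (intros t E; rewrite Eh in E; now apply (PLF_inj u)).
  (* k fixes the first fixed point u a of h'. It lies in (0, a), so k is trivial there. This
     interval reaches into the last bump (u b, r) of h', on which k is therefore trivial too. *)
  assert (Kua : k (u a) = u a).
  { apply (first_fixed_point_commutes h' k); auto; [now rewrite Eh, Ea|].
    intros t Ht E. destruct (PLF_surj u t Pu) as [s <-]. apply Fh' in E. apply (Fa s); auto.
    split; apply (PLF_lt_inv u); auto; rewrite ?PLF_zero by auto; lra. }
  assert (K1 : forall t, 0 < t < a -> k t = t).
  { apply (commuting_fixed_point h k 0 a (u a)); auto; try lra. now apply PLF_zero. }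
  assert (K2 : forall t, u b < t < r -> k t = t).
  { apply (commuting_fixed_point h' k (u b) r ((u b + a) / 2)); auto; try lra.
    - now rewrite Eh, Eb.
    - intros t Ht E. destruct (PLF_surj u t Pu) as [s <-]. apply Fh' in E. apply (Fb s); auto.
      split; apply (PLF_lt_inv u); auto; rewrite ?PLF_r by auto; lra.
    - apply K1. lra. }
  apply PLF_eq_id; auto. intros t Ht. destruct (Rlt_dec t a); [apply K1|apply K2]; lra.
Qed.

(** With no fixed points to displace, u is chosen trivial near 0 but not everywhere. A common
    centralizing k then commutes with u. If k were nontrivial it would have no interior fixed point,
    and u, which fixes c, would be the identity. *)
Lemma separating_conjugator_fixed_point_free h : PLF h -> (forall t, 0 < t < r -> h t <> t) ->
  exists u, PLF u /\ forall k, PLF k -> commutes h k -> commuting_conjugate h u k -> k = id.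
Proof.
  intros Ph Fh. destruct (right_bump_ex 0 r) as (c & u & Hc & Pu & U1 & U2 & _ & _); try lra.
  exists u. split; [auto|]. intros k Pk Ck (h' & Ph' & Eh' & Ck').
  assert (Eh : forall t, h' (u t) = u (h t)) by (intros t; exact (f_equal (fun f => f t) Eh')).
  destruct (PLF_inv u Pu) as (w & Pw & W1 & W2). destruct (PLF_inv k Pk) as (k1 & Pk1 & I1 & I2).
  rewrite commutes_iff in Ck'.
  (* The conjugate u k w commutes with h and has the same germ at 0 as k. *)
  assert (Q : (fun t => k1 (w (k (u t)))) = id).
  { set (s := Rmin c (k1 c)).
    assert (0 < k1 c < r) by (apply PLF_range; auto).
    assert (0 < s) by (apply Rmin_glb_lt; lra).
    assert (s <= c) by apply Rmin_l. assert (s <= k1 c) by apply Rmin_r.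
    apply (commuting_fixed_point_id h _ s); auto; try lra.
    - exact (PLF_comp _ _ (PLF_comp _ _ (PLF_comp _ _ Pu Pk) Pw) Pk1).
    - apply commutes_iff. intros t.
      apply (PLF_inj k); auto. rewrite I2.
      rewrite commutes_iff in Ck. rewrite Ck, I2.
      apply (PLF_inj u); auto. now rewrite W2, <- !Eh, W2, Ck'.
    - rewrite U1 by lra.
      assert (k s <= c) by (rewrite <- (I2 c); apply PLF_incr_le; auto).
      rewrite <- (U1 (k s)), W1 by auto. apply I1. }
  assert (Cu : commutes k u).
  { apply commutes_iff. intros t. rewrite <- (W2 (k (u t))). f_equal.
    rewrite <- (I2 (w _)). f_equal. symmetry. exact (f_equal (fun f => f t) Q). }
  apply NNPP. intros Nk.
  assert (Fk : forall t, 0 < t < r -> k t <> t).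
  { intros t Ht E. apply Nk. now apply (commuting_fixed_point_id h k t). }
  assert (Eu : u = id) by (apply (commuting_fixed_point_id k u c); auto; apply U1; lra).
  assert (L : u ((c + r) / 2) < (c + r) / 2) by (apply U2; lra). rewrite Eu in L. lra.
Qed.

Lemma thin_characterization h : PLF h ->
  (thin val h <-> forall u, PLF u ->
     exists k, PLF k /\ k <> id /\ commutes h k /\ commuting_conjugate h u k).
Proof.
  intros Ph. split; [intros T u Pu; now apply thin_centralizers|].
  intros H. apply NNPP. intros NT.
  assert (exists u, PLF u /\ forall k, PLF k -> commutes h k -> commuting_conjugate h u k -> k = id)
    as (u & Pu & Hu).
  { destruct (classic (exists t, 0 < t < r /\ h t = t)) as [(t & Ht & E)|N].
    - now apply (separating_conjugator h t).
    - apply separating_conjugator_fixed_point_free; eauto. }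
  destruct (H u Pu) as (k & Pk & Nk & Ck & Hk). auto.
Qed.

(** The h that are tested play the role of the elements supported in the neighbourhood of the end
    where k is trivial. Commutation with k1 keeps this neighbourhood small, and commutation of the
    conjugates with k says that x maps it into itself. *)
Definition contracting (e : bool) (x : R -> R) : Prop :=
  forall k1, PLF k1 -> val e k1 = 0%Z -> k1 <> id ->
  exists k, PLF k /\ val e k = 0%Z /\ k <> id /\
    forall h, PLF h -> val (negb e) h = 0%Z -> commutes h k ->
      commutes h k1 /\ commuting_conjugate h x k.

Lemma contracting_reflect e x : contracting e (reflect x) -> contracting (negb e) x.
Proof.
  intros H k1 P1 V1 N1.
  destruct (H (reflect k1)) as (k & Pk & Vk & Nk & Hk).
  - now apply PLF_reflect.
  - now rewrite val_reflect.
  - intros E. apply N1, reflect_inj. now rewrite E, reflect_id.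
  - exists (reflect k). split; [now apply PLF_reflect|].
    split; [now rewrite val_reflect, Bool.negb_involutive|split].
    + intros E. apply Nk, reflect_inj. now rewrite E, reflect_id.
    + intros h Ph Vh Ch.
      destruct (Hk (reflect h)) as [C1 C2].
      * now apply PLF_reflect.
      * rewrite val_reflect. exact Vh.
      * apply commutes_reflect in Ch. now rewrite reflect_reflect in Ch.
      * split; [|now apply conjugate_reflect].
        apply commutes_reflect in C1. now rewrite !reflect_reflect in C1.
Qed.

Lemma nonneg_contracting x : PLF x -> (0 <= val true x)%Z -> contracting true x.
Proof.
  intros Px V k1 P1 V1 _.
  destruct (val_spec true x Px) as (eps & Pe & He). set (z := val true x) in *.
  assert (Hx : forall t, 0 <= t <= eps -> x t <= t).
  { intros t Ht. rewrite He by auto.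
    assert (powerRZ g z <= 1); [|nra].
    destruct (Z.eq_dec z 0) as [->|Hz]; [simpl; lra|]. apply Rlt_le, powerRZ_lt1. lia. }
  apply val_zero in V1 as (eps1 & Pe1 & H1); auto.
  set (e := Rmin eps (Rmin eps1 r)).
  assert (0 < e) by (repeat apply Rmin_glb_lt; auto).
  assert (e <= eps /\ e <= eps1 /\ e <= r) as (B1 & B2 & B3).
  { unfold e. pose proof (Rmin_l eps (Rmin eps1 r)). pose proof (Rmin_r eps (Rmin eps1 r)).
    pose proof (Rmin_l eps1 r). pose proof (Rmin_r eps1 r). lra. }
  destruct (right_bump_ex 0 e) as (c & k & Hc & Pk & K1 & K2 & Vk & _); try lra.
  exists k. split; [auto|split; [auto|split]].
  { apply not_id with ((c + r) / 2). assert (k ((c + r) / 2) < (c + r) / 2) by (apply K2; lra). lra. }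
  intros h Ph Vh Ch. apply val_zero_right in Vh as (s & Ps & Hs); auto.
  (* k has no fixed point in (c, r) and h is trivial near r, so h is trivial on all of (c, r). Hence
     h lives on [0, c], which x maps into itself. *)
  assert (Hid : forall t, c <= t -> h t = t).
  { assert (Hin : forall t, c < t < r -> h t = t).
    { apply (commuting_fixed_point k h c r ((Rmax s c + r) / 2)); auto; try lra.
      - now apply commute_sym.
      - apply K1. lra.
      - intros t Ht. specialize (K2 t Ht). lra.
      - assert (c <= Rmax s c) by apply Rmax_r. assert (Rmax s c < r) by (apply Rmax_lub_lt; lra). lra.
      - apply Hs. assert (s <= Rmax s c) by apply Rmax_l. assert (Rmax s c < r) by (apply Rmax_lub_lt; lra). lra. }
    intros t [Ht| <-].
    - destruct (Rlt_dec t r); [apply Hin; lra|]. apply Ph. lra.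
    - assert (Ec : reflect h (r - c) = r - c).
      { apply (first_fixed_point_commutes (reflect k)); try now apply PLF_reflect.
        - now apply commutes_reflect, commute_sym.
        - lra.
        - unfold reflect. replace (r - (r - c)) with c by ring. rewrite K1 by lra. ring.
        - intros t Ht E. specialize (K2 (r - t)). unfold reflect in E. lra. }
      unfold reflect in Ec. replace (r - (r - c)) with c in Ec by ring. lra. }
  split.
  - apply (commutes_disjoint h k1 c); auto. intros t Ht. apply H1. lra.
  - destruct (conjugate_ex h x Ph Px) as (h' & Ph' & E' & F'). exists h'. split; [auto|split; auto].
    apply (commutes_disjoint h' k c); auto. intros t Ht.
    destruct (PLF_surj x t Px) as [q <-]. apply F', Hid. apply Rnot_lt_le. intros L.
    apply (PLF_incr x) in L; auto. assert (x c <= c) by (apply Hx; lra). lra.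
Qed.

(** If the value were negative, x would expand near 0. Let c be maximal with k trivial below c.
    Bumps on (0, d) with d < c commute with k, hence with k1, which keeps c where x expands; and
    their conjugates commute with k, which makes k trivial up to x c > c. *)
Lemma contracting_nonneg x : PLF x -> contracting true x -> (0 <= val true x)%Z.
Proof.
  intros Px H. apply Z.nlt_ge. intros V.
  destruct (val_spec true x Px) as (eps & Pe & He). set (z := val true x) in *.
  assert (Hx : forall t, 0 < t <= eps -> t < x t).
  { intros t Ht. rewrite He by lra. pose proof (powerRZ_decr z 0 V) as L. simpl in L. nra. }
  assert (0 < Rmin eps r) by (apply Rmin_glb_lt; auto).
  assert (Rmin eps r <= eps) by apply Rmin_l. assert (Rmin eps r <= r) by apply Rmin_r.
  destruct (right_bump_ex 0 (Rmin eps r)) as (c1 & k1 & Hc1 & P1 & I1 & M1 & V1 & _); try lra.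
  destruct (H k1 P1 V1) as (k & Pk & Vk & Nk & Hk).
  { apply not_id with ((c1 + r) / 2).
    assert (k1 ((c1 + r) / 2) < (c1 + r) / 2) by (apply M1; lra). lra. }
  apply val_zero in Vk as (e0 & Pe0 & Ke); auto.
  destruct (completeness (fun s => s <= r /\ forall t, t <= s -> k t = t)) as [c [Ub Lub]].
  { exists r. intros s [Hs _]. auto. }
  { exists 0. split; [lra|]. intros t Ht. apply Ke. lra. }
  assert (C0 : 0 < c).
  { assert (0 < Rmin e0 r) by (apply Rmin_glb_lt; auto).
    assert (Rmin e0 r <= c); [|lra]. apply Ub. split; [apply Rmin_r|].
    intros t Ht. apply Ke. assert (Rmin e0 r <= e0) by apply Rmin_l. lra. }
  assert (Cr : c <= r) by (apply Lub; intros s [Hs _]; auto).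
  assert (Kc : forall t, t < c -> k t = t).
  { intros t Ht. apply NNPP. intros N. assert (c <= t); [|lra]. apply Lub.
    intros s [_ Hs]. apply Rnot_lt_le. intros L. apply N, Hs. lra. }
  assert (Test : forall lo hi, 0 <= lo -> lo < hi -> hi <= c -> exists d, lo < d < hi /\ k1 d = d /\ k (x d) = x d).
  { intros lo hi Hlo Hlh Hhi.
    destruct (left_bump_ex 1 lo hi) as (d & h & Hd & Ph & F1 & F2 & _); try lra; [lia|].
    exists d. split; [auto|].
    assert (Fd : forall t, 0 < t < d -> h t <> t) by (intros t Ht; specialize (F2 t Ht); lra).
    destruct (Hk h Ph) as [C1 (h' & Ph' & E' & C')].
    { apply val_zero_right; auto. exists d. split; [lra|auto]. }
    { apply (commutes_disjoint h k d); auto. intros t Ht. apply Kc. lra. }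
    assert (Eh : forall t, h' (x t) = x (h t)) by (intros t; exact (f_equal (fun f => f t) E')).
    split.
    - apply (first_fixed_point_commutes h k1); auto; [lra|]. apply F1. lra.
    - apply (first_fixed_point_commutes h' k); auto.
      + apply PLF_range; auto. lra.
      + rewrite Eh, F1 by lra. reflexivity.
      + intros t Ht E. destruct (PLF_surj x t Px) as [s <-]. rewrite Eh in E.
        apply (Fd s); [|now apply (PLF_inj x)].
        split; apply (PLF_lt_inv x); auto; rewrite ?PLF_zero by auto; lra. }
  assert (Cc1 : c <= c1).
  { apply Rnot_lt_le. intros L. destruct (Test c1 c) as (d & Hd & E & _); try lra.
    assert (k1 d < d) by (apply M1; lra). lra. }
  assert (Cx : c < x c) by (apply Hx; lra).
  assert (Xr : x c < r) by (apply PLF_range; auto; lra).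
  (* By [Test], k fixes x d for a dense set of d in (0, c); being increasing, it fixes every point
     below x c. *)
  assert (Kx : forall t, t < x c -> k t = t).
  { intros t Ht. destruct (Rle_dec t 0); [apply Pk; lra|].
    destruct (PLF_surj x t Px) as [q Eq]. destruct (PLF_surj x (k t) Px) as [p Ep].
    assert (Hq : 0 < q < c) by (split; apply (PLF_lt_inv x); auto; rewrite ?PLF_zero by auto; lra).
    assert (Hp : 0 < p).
    { apply (PLF_lt_inv x); auto. rewrite PLF_zero, Ep by auto. apply PLF_range; auto. lra. }
    destruct (Rtotal_order (k t) t) as [L|[E|L]]; auto; exfalso.
    - assert (p < q) by (apply (PLF_lt_inv x); auto; lra).
      destruct (Test p q) as (d & Hd & _ & E); try lra.
      assert (x d < x q) by (apply PLF_incr; auto; lra). assert (x p < x d) by (apply PLF_incr; auto; lra).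
      assert (k (x d) < k t) by (apply PLF_incr; auto; lra). lra.
    - assert (q < p) by (apply (PLF_lt_inv x); auto; lra).
      assert (q < Rmin p c) by (apply Rmin_glb_lt; lra).
      assert (Rmin p c <= p) by apply Rmin_l. assert (Rmin p c <= c) by apply Rmin_r.
      destruct (Test q (Rmin p c)) as (d & Hd & _ & E); try lra.
      assert (x q < x d) by (apply PLF_incr; auto; lra). assert (x d < x p) by (apply PLF_incr; auto; lra).
      assert (k t < k (x d)) by (apply PLF_incr; auto; lra). lra. }
  assert ((c + x c) / 2 <= c); [|lra]. apply Ub. split; [lra|]. intros t Ht. apply Kx. lra.
Qed.

Lemma contracting_iff e x : PLF x -> ((0 <= val e x)%Z <-> contracting e x).
Proof.
  assert (K : forall x, PLF x -> ((0 <= val true x)%Z <-> contracting true x)).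
  { intros y Py. split; [now apply nonneg_contracting|now apply contracting_nonneg]. }
  intros Px. destruct e; auto.
  pose proof (val_reflect true x) as E. simpl in E. rewrite <- E, K by now apply PLF_reflect.
  split; [apply contracting_reflect|]. intros H. apply (contracting_reflect false).
  now rewrite reflect_reflect.
Qed.

Lemma PLF_two_ended : two_ended PLF Fop id val.
Proof.
  constructor.
  - exact PLF_id.
  - intros x y Hx Hy. exact (PLF_comp x y Hx Hy).
  - intros x Hx. destruct (PLF_inv x Hx) as (y & Hy & H1 & H2). exists y.
    split; [auto|]. split; apply functional_extensionality; assumption.
  - reflexivity.
  - reflexivity.
  - reflexivity.
  - exact val_comp.
  - exact thin_characterization.
  - exact contracting_iff.
  - intros e m Hm. destruct (left_mover_ex m Hm) as (x & Px & Mx & V1 & V2).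
    assert (Fx : forall t, 0 < t < r -> x t <> t) by (intros t Ht; specialize (Mx t Ht); lra).
    destruct e.
    + exists x. split; [auto|split; [now apply fixed_point_free_rigid|auto]].
    + exists (reflect x). rewrite !val_reflect. split; [now apply PLF_reflect|split; [|auto]].
      apply fixed_point_free_rigid; [now apply PLF_reflect|]. intros t Ht E.
      apply (Fx (r - t)); [lra|]. unfold reflect in E. lra.
  - intros e. destruct (right_bump_ex 0 r) as (c & p & _ & Pp & _ & _ & V1 & V2); try lra.
    destruct e.
    + exists p. simpl. rewrite V1, V2. split; [auto|split; [auto|lia]].
    + exists (reflect p). rewrite !val_reflect. simpl. rewrite V1, V2.
      split; [now apply PLF_reflect|split; [auto|lia]].
Qed.

Lemma inF_interprets_arith : interprets_arith (inF r Lam A) Fop.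
Proof. rewrite inF_eq. exact (two_ended_interprets_arith _ _ _ _ PLF_two_ended). Qed.

End PiecewiseAffine.

(** * Normalization of the generator *)

Lemma cyclic_generator_lt1 (Lam : R -> Prop) :
  (forall l, Lam l -> (0 < l)%R) -> (exists l, Lam l /\ l <> 1%R) ->
  (exists g, forall l, Lam l <-> exists z : Z, l = powerRZ g z) ->
  exists g, (0 < g < 1)%R /\ forall l, Lam l <-> exists z : Z, l = powerRZ g z.
Proof.
  intros Lpos (l & Hl & Hl1) (g & Hg).
  assert (Pg : (0 < g)%R) by (apply Lpos, Hg; exists 1%Z; simpl; ring).
  destruct (Rtotal_order g 1) as [L|[->|L]].
  - exists g. auto.
  - exfalso. apply Hl1. apply Hg in Hl as [z ->]. apply powerRZ_R1.
  - exists (/ g)%R. split.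
    + split; [now apply Rinv_0_lt_compat|]. rewrite <- Rinv_1. apply Rinv_lt_contravar; lra.
    + intros m. rewrite Hg. split; intros [z ->]; exists (- z)%Z; rewrite powerRZ_neg', powerRZ_inv', ?Rinv_inv; auto.
Qed.

Open Scope R_scope.

Theorem theoremB (r : R) (Lam A : R -> Prop) :
  0 < r ->
  (* Lambda is a subgroup of R*_+, different from {1} *)
  (forall l, Lam l -> 0 < l) -> Lam 1 ->
  (forall l m, Lam l -> Lam m -> Lam (l * m)) ->
  (forall l, Lam l -> Lam (/ l)) ->
  (exists l, Lam l /\ l <> 1) ->
  (* A is an additive subgroup of R, r in A, Lambda A ⊆ A *)
  A 0 -> (forall a b, A a -> A b -> A (a + b)) -> (forall a, A a -> A (- a)) ->
  A r -> (forall l a, Lam l -> A a -> A (l * a)) ->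
  (* Lambda is cyclic *)
  (exists g, forall l, Lam l <-> exists z : Z, l = powerRZ g z) ->
  interprets_arith (inF r Lam A) Fop.
Proof.
  intros Pr Lpos _ _ _ Lnt A0 Aadd Aopp Ar Asc Lcyc.
  destruct (cyclic_generator_lt1 Lam Lpos Lnt Lcyc) as (g & [G0 G1] & Hg).
  now apply inF_interprets_arith with g.
Qed.
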